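(* Let $k$ be an algebraically closed field of characteristic $p\ge 3$, and let $X$ be a hyperelliptic curve over $k$ of genus $g\ge2$ with function field $K(X)=k(x,y)$, where $y^2=f(x)$ with $f(x)\in k[x]$ monic without repeated roots. Assume that the degree of $f(x)$ is odd. Assume furthermore that there exists $\tau\in\mathrm{Aut}(X)$ such that the induced map $\bar\tau\colon\mathbb{P}^1_k\to\mathbb{P}^1_k$ is given by $x\mapsto x+a$ for some $a\in k$, $a\ne 0$. Let $G$ denote the subgroup of $\mathrm{Aut}(X)$ generated by $\tau$. Then the Hodge-de-Rham short exact sequence $$0\to H^0(X,\Omega_X)\to H^1_{\mathrm{dR}}(X/k)\to H^1(X,\mathcal{O}_X)\to 0$$ does not split as a sequence of $k[G]$-modules.
   Context: Curves are smooth, projective and irreducible. A curve $X$ over $k$ is hyperelliptic if there is a finite separable morphism $\pi\colon X\to\mathbb{P}^1_k$ of degree two; here $\pi$ is the fixed such map corresponding to the function field extension $K(X)=k(x,y)/k(x)$, and $\deg f=2g+1$ if $\infty$ is a branch point of $\pi$ and $\deg f=2g+2$ otherwise. Every $\tau\in\mathrm{Aut}(X)$ induces a unique automorphism $\bar\tau$ of $\mathbb{P}^1_k$ with $\pi\circ\tau=\bar\tau\circ\pi$ (since $\mathbb{P}^1_k$ is the quotient of $X$ by the hyperelliptic involution, which is central in $\mathrm{Aut}(X)$). $H^1_{\mathrm{dR}}(X/k)$ is the first hypercohomology of the de-Rham complex $\mathcal{O}_X\xrightarrow{d}\Omega_X$. The Hodge-de-Rham short exact sequence is the part $0 \to H^0(X,\Omega_X)\to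 H^1_{\mathrm{dR}}(X/k)\to H^1(X,\mathcal{O}_X)\to 0$ (which is exact) of the long exact sequence relating $H^*_{\mathrm{dR}}(X/k)$ to the cohomology of $\mathcal{O}_X$ and $\Omega_X$. The group $G$ acts on all three terms by pull-back, and the maps are $k[G]$-linear. The sequence splits as a sequence of $k[G]$-modules if there is a $k[G]$-linear map $s\colon H^1(X,\mathcal{O}_X)\to H^1_{\mathrm{dR}}(X/k)$ whose composition with the projection $H^1_{\mathrm{dR}}(X/k)\to H^1(X,\mathcal{O}_X)$ is the identity. *)

(* Defs.v *)
From HB Require Import structures.
From mathcomp Require Import all_boot all_algebra.
From mathcomp Require Import boolp classical_sets functions cardinality.
From mathcomp Require Import freeg.

Set Implicit Arguments.
Unset Strict Implicit.
Unset Printing Implicit Defensive.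

Import GRing.Theory.
Local Open Scope classical_set_scope.
Local Open Scope ring_scope.
Local Open Scope quotient_scope.

#[short(type="fieldAlgType")]
HB.structure Definition FieldAlgebra (k : fieldType) :=
  {K of GRing.Field K & GRing.Algebra k K}.

Record submodule (R : pzRingType) (V : lmodType R) := Submodule {
  sm_set :> V -> Prop;
  sm_closed : sm_set 0 /\
    forall a u v, sm_set u -> sm_set v -> sm_set (a *: u + v)
}.

Section Submodules.
Variables (R : pzRingType) (V : lmodType R).

Definition smpred (S : submodule V) : {pred V} := fun v => `[< S v >].

Lemma smpredP (S : submodule V) v : reflect (S v) (v \in smpred S).
Proof. exact: asboolP. Qed.

Lemma smpred_closed (S : submodule V) : submod_closed (smpred S).
Proof.
split=> [|a u v /smpredP Su /smpredP Sv]; apply/smpredP.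
  exact: (sm_closed S).1.
exact: (sm_closed S).2.
Qed.

HB.instance Definition _ (S : submodule V) :=
  GRing.isSubmodClosed.Build R V (smpred S) (smpred_closed S).

Definition smtype (S : submodule V) := {v : V | v \in smpred S}.

HB.instance Definition _ S := SubType.copy (smtype S) {v : V | v \in smpred S}.
HB.instance Definition _ S := Choice.copy (smtype S) {v : V | v \in smpred S}.
HB.instance Definition _ S := [SubChoice_isSubLmodule of smtype S by <:].

Lemma span_closed (A : set V) :
  let s v := forall S : submodule V, (forall w, A w -> S w) -> S v in
  s 0 /\ forall a u v, s u -> s v -> s (a *: u + v).
Proof.
split=> [S _|a u v su sv S AS]; first exact: (sm_closed S).1.
by apply: (sm_closed S).2; [exact: su|exact: sv].
Qed.

Definition span (A : set V) : submodule V := Submodule (span_closed A).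

Section Quotient.
Variable S : submodule V.

Definition quotm := Quotient.quot (smpred S).

HB.instance Definition _ := GRing.Zmodule.on quotm.
HB.instance Definition _ := EqQuotient.on quotm.

Definition quotm_scale (a : R) (c : quotm) : quotm := \pi_quotm (a *: repr c).

Lemma quotm_eq (u v : V) : \pi_quotm u = \pi_quotm v <-> S (u - v).
Proof.
split=> [/eqP|/smpredP uv]; first by rewrite -Quotient.idealrBE => /smpredP.
by apply/eqP; rewrite -Quotient.idealrBE.
Qed.

Lemma pi_surj (c : quotm) : exists v : V, c = \pi_quotm v.
Proof. by exists (repr c); rewrite reprK. Qed.

Lemma pi_quotmD (u v : V) : \pi_quotm (u + v) = \pi_quotm u + \pi_quotm v.
Proof. exact: (raddfD (\pi_(Quotient.quot (smpred S)))). Qed.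

Lemma pi_quotmZ a (v : V) : \pi_quotm (a *: v) = quotm_scale a (\pi_quotm v).
Proof.
apply/quotm_eq; rewrite -scalerBr -[_ *: _]addr0.
apply: (sm_closed S).2; last exact: (sm_closed S).1.
by apply/quotm_eq; rewrite reprK.
Qed.

Fact quotm_scaleA a b c :
  quotm_scale a (quotm_scale b c) = quotm_scale (a * b) c.
Proof. by have [v ->] := pi_surj c; rewrite -!pi_quotmZ scalerA. Qed.

Fact quotm_scale1 : left_id 1 quotm_scale.
Proof. by move=> c; have [v ->] := pi_surj c; rewrite -pi_quotmZ scale1r. Qed.

Fact quotm_scaleDr : right_distributive quotm_scale +%R.
Proof.
move=> a b c; have [u ->] := pi_surj b; have [v ->] := pi_surj c.
by rewrite -pi_quotmD -!pi_quotmZ -pi_quotmD scalerDr.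
Qed.

Fact quotm_scaleDl c : {morph quotm_scale^~ c : a b / a + b}.
Proof.
move=> a b; have [v ->] := pi_surj c.
by rewrite -!pi_quotmZ -pi_quotmD scalerDl.
Qed.

HB.instance Definition _ := GRing.Zmodule_isLmodule.Build R quotm
  quotm_scaleA quotm_scale1 quotm_scaleDr quotm_scaleDl.

Lemma pi_quotm_scale a (v : V) : \pi_quotm (a *: v) = a *: (\pi_quotm v : quotm).
Proof. exact: pi_quotmZ. Qed.

End Quotient.

End Submodules.

Section Subquotient.
Variables (R : pzRingType).

Lemma restrict_closed (V : lmodType R) (Z B : submodule V) :
  let s (z : smtype Z) := B (val z) in
  s 0 /\ forall a u v, s u -> s v -> s (a *: u + v).
Proof.
split=> [|a u v /= Bu Bv]; first by rewrite raddf0; exact: (sm_closed B).1.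
exact: (sm_closed B).2.
Qed.

Definition restrict (V : lmodType R) (Z B : submodule V) :
  submodule (smtype Z) := Submodule (restrict_closed Z B).

Definition subquot (V : lmodType R) (Z B : submodule V) : lmodType R :=
  quotm (restrict Z B).

Definition sqclass (V : lmodType R) (Z B : submodule V) (v : V) :
  subquot Z B := \pi_(quotm (restrict Z B)) (insubd 0 v).

Definition sqrepr (V : lmodType R) (Z B : submodule V) (c : subquot Z B) : V :=
  val (repr (c : quotm (restrict Z B))).

(* The map of subquotients induced by phi; meaningful when phi is additive, maps
   Z to Z' and B to B', see sqmap_class. *)
Definition sqmap (V V' : lmodType R) (Z B : submodule V) (Z' B' : submodule V')
  (phi : V -> V') (c : subquot Z B) : subquot Z' B' :=
  sqclass Z' B' (phi (sqrepr c)).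

Lemma sqclass_eq (V : lmodType R) (Z B : submodule V) u v :
  Z u -> Z v -> sqclass Z B u = sqclass Z B v <-> B (u - v).
Proof.
move=> /smpredP Zu /smpredP Zv; rewrite /sqclass quotm_eq.
rewrite -[X in _ <-> B (X - _)](insubdK (0 : smtype Z) Zu).
by rewrite -[X in _ <-> B (_ - X)](insubdK (0 : smtype Z) Zv).
Qed.

Lemma sqreprP (V : lmodType R) (Z B : submodule V) (c : subquot Z B) :
  Z (sqrepr c) /\ sqclass Z B (sqrepr c) = c.
Proof.
split; first by apply/smpredP; exact: valP.
by rewrite /sqclass /sqrepr valKd reprK.
Qed.

Lemma sqmap_class (V V' : lmodType R) (Z B : submodule V)
    (Z' B' : submodule V') (phi : V -> V') :
  {morph phi : u v / u - v} -> (forall v, Z v -> Z' (phi v)) ->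
  (forall v, B v -> B' (phi v)) ->
  forall v, Z v -> sqmap Z' B' phi (sqclass Z B v) = sqclass Z' B' (phi v).
Proof.
move=> phiB ZZ BB v Zv; have [Zr cr] := sqreprP (sqclass Z B v).
apply/sqclass_eq; [exact: ZZ|exact: ZZ|rewrite -phiB; apply: BB].
exact/(sqclass_eq B Zr Zv).
Qed.

End Subquotient.

(* Kaehler differentials of K over k: the free K-module on symbols d z, modulo
   additivity, the Leibniz rule and d c = 0 for c in k. *)

Section Kaehler.
Variables (k : fieldType) (K : fieldAlgType k).

Definition dsymb (z : K) : {freeg K / K} := [freeg [:: (1, z)]].

Definition kaehler_rel : set {freeg K / K} := [set w |
  [\/ exists z1 z2, w = dsymb (z1 + z2) - (dsymb z1 + dsymb z2),
      exists z1 z2, w = dsymb (z1 * z2) - (z1 *: dsymb z2 + z2 *: dsymb z1)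
    | exists c : k, w = dsymb c%:A]].

Definition Omega := quotm (span kaehler_rel).
HB.instance Definition _ := GRing.Lmodule.on Omega.

Definition dK (z : K) : Omega := \pi_(quotm (span kaehler_rel)) (dsymb z).

Definition is_derivation (M : lmodType K) (delta : K -> M) :=
  [/\ {morph delta : z w / z + w},
      forall z w, delta (z * w) = z *: delta w + w *: delta z
    & forall c : k, delta c%:A = 0].

(* Independent of the representative when delta is a derivation, see
   Omega_lift_pi; Omega_universal is the universal property of Omega. *)
Definition Omega_lift (M : lmodType K) (delta : K -> M) (w : Omega) : M :=
  fglift delta (repr (w : quotm (span kaehler_rel))).

Section Lift.
Variables (M : lmodType K) (delta : K -> M).

Lemma fglift_scalar a (w : {freeg K / K}) :
  fglift delta (a *: w) = a *: fglift delta w.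
Proof.
have fgB := @lift_is_additive _ _ M delta.
pose F : {additive {freeg K / K} -> M} :=
  HB.pack (fglift delta) (GRing.isZmodMorphism.Build _ _ _ fgB).
rewrite -[RHS]/(a *: F w) -{2}[w]freeg_sumE (raddf_sum F) scaler_sumr.
rewrite -[LHS]/(F (fgscale a w)) /fgscale (raddf_sum F).
by apply: eq_bigr => z _; rewrite /F /= !liftU scalerA.
Qed.

Lemma lift_ker_closed : let s w := fglift delta w = 0 in
  s 0 /\ forall a u v, s u -> s v -> s (a *: u + v).
Proof.
have fgB := @lift_is_additive _ _ M delta.
have fg0 : fglift delta 0 = 0 by rewrite -(subrr 0) fgB subrr.
split=> // a u v /= u0 v0; rewrite -[v]opprK fgB fglift_scalar u0 scaler0.
by rewrite -[- v]add0r fgB v0 fg0 !subrr.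
Qed.

Hypothesis deltaP : is_derivation delta.

Lemma Omega_lift_pi w :
  Omega_lift delta (\pi_(quotm (span kaehler_rel)) w) = fglift delta w.
Proof.
have [dD dM dC] := deltaP; have fgB := @lift_is_additive _ _ M delta.
have fgD u v : fglift delta (u + v) = fglift delta u + fglift delta v.
  have fg0 : fglift delta 0 = 0 by rewrite -(subrr 0) fgB subrr.
  by rewrite -[v in LHS]opprK fgB -[- v]add0r fgB fg0 sub0r opprK.
have dsymbE z : fglift delta (dsymb z) = delta z by rewrite liftU scale1r.
apply/eqP; rewrite -subr_eq0 -fgB; apply/eqP.
have /quotm_eq : \pi_(quotm (span kaehler_rel))
    (repr (\pi_(quotm (span kaehler_rel)) w)) =
  \pi_(quotm (span kaehler_rel)) w by rewrite reprK.
move=> /(_ (Submodule lift_ker_closed)); apply=> {}w [] /=.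
- by case=> z1 [z2 ->]; rewrite fgB fgD !dsymbE dD subrr.
- by case=> z1 [z2 ->]; rewrite fgB fgD !fglift_scalar !dsymbE dM subrr.
- by case=> c ->; rewrite dsymbE dC.
Qed.

Lemma Omega_lift_linear : linear (Omega_lift delta : Omega -> M).
Proof.
have fgB := @lift_is_additive _ _ M delta.
have fg0 : fglift delta 0 = 0 by rewrite -(subrr 0) fgB subrr.
move=> a u v; have [{}u ->] := pi_surj u; have [{}v ->] := pi_surj v.
have -> : a *: (\pi_(quotm (span kaehler_rel)) u : Omega) +
    \pi_(quotm (span kaehler_rel)) v =
    \pi_(quotm (span kaehler_rel)) (a *: u + v).
  by rewrite pi_quotmD pi_quotmZ.
rewrite !Omega_lift_pi -[v in LHS]opprK fgB fglift_scalar.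
by rewrite -[- v]add0r fgB fg0 sub0r opprK.
Qed.

Lemma Omega_lift_d z : Omega_lift delta (dK z) = delta z.
Proof. by rewrite /dK Omega_lift_pi liftU scale1r. Qed.

End Lift.

Lemma dK_derivation : is_derivation dK.
Proof.
split.
- move=> z w; rewrite /dK -pi_quotmD; apply/quotm_eq => S; apply.
  by apply: Or31; exists z, w.
- move=> z w; rewrite /dK -2!pi_quotm_scale -pi_quotmD.
  apply/quotm_eq => S; apply.
  by apply: Or32; exists z, w.
- move=> c; rewrite /dK -[RHS](raddf0 (\pi_(Quotient.quot (smpred (span kaehler_rel))))).
  by apply/quotm_eq => S; rewrite subr0; apply; apply: Or33; exists c.
Qed.

Lemma Omega_spanned (w : Omega) :
  exists s : seq (K * K), w = \sum_(p <- s) p.1 *: dK p.2.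
Proof.
have [v ->] := pi_surj w; exists [seq (coeff z v, z) | z <- dom v].
rewrite big_map -[v in LHS]freeg_sumE.
rewrite (raddf_sum (\pi_(Quotient.quot (smpred (span kaehler_rel))))).
apply: eq_bigr => z _ /=; rewrite -pi_quotm_scale; congr (\pi_(_) _).
by apply/eqP/freeg_eqP => t; rewrite coeffZ !coeffU mul1r.
Qed.

Lemma Omega_universal (M : lmodType K) (delta : K -> M) : is_derivation delta ->
  exists! phi : Omega -> M, linear phi /\ forall z, phi (dK z) = delta z.
Proof.
move=> dP; exists (Omega_lift delta); split.
  by split; [exact: Omega_lift_linear|exact: Omega_lift_d].
move=> phi [phiL phid]; apply/funext => w; have [s ->] := Omega_spanned w.
have lin0 (f : Omega -> M) : linear f -> f 0 = 0.
  by move=> fL; have := fL (-1) 0 0; rewrite scaler0 addr0 scaleN1r addNr.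
elim: s => [|p s IH]; first by rewrite big_nil !lin0 //; exact: Omega_lift_linear.
by rewrite big_cons (Omega_lift_linear dP) phiL phid Omega_lift_d // IH.
Qed.

(* A copy of Omega, which is already a module over K, as a module over k. *)
Definition Omega_k : Type := Omega.
HB.instance Definition _ := GRing.Zmodule.copy Omega_k Omega.

Definition Omega_scale (c : k) (w : Omega_k) : Omega_k :=
  (c%:A : K) *: (w : Omega).

Fact Omega_scaleA a b w :
  Omega_scale a (Omega_scale b w) = Omega_scale (a * b) w.
Proof. by rewrite /Omega_scale scalerA -scalerAl mul1r scalerA. Qed.
Fact Omega_scale1 : left_id 1 Omega_scale.
Proof. by move=> w; rewrite /Omega_scale !scale1r. Qed.
Fact Omega_scaleDr : right_distributive Omega_scale +%R.
Proof. by move=> a u v; exact: scalerDr. Qed.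
Fact Omega_scaleDl w : {morph Omega_scale^~ w : a b / a + b}.
Proof. by move=> a b; rewrite /Omega_scale scalerDl; exact: scalerDl. Qed.

HB.instance Definition _ := GRing.Zmodule_isLmodule.Build k Omega_k
  Omega_scaleA Omega_scale1 Omega_scaleDr Omega_scaleDl.

End Kaehler.

(* Automorphisms of the curve. The curve X is given by its function field K, and
   an automorphism t of X by the pull-back t^* : K -> K, so that
   (s t)^* = t^* s^*. *)

Section Automorphisms.
Variables (k : fieldType) (K : fieldAlgType k).

Definition is_kaut (phi : K -> K) : Prop :=
  [/\ linear phi, monoid_morphism phi & bijective phi].

Definition curve_aut := {phi : K -> K | `[< is_kaut phi >]}.
HB.instance Definition _ :=
  SubType.copy curve_aut {phi : K -> K | `[< is_kaut phi >]}.
HB.instance Definition _ :=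
  Choice.copy curve_aut {phi : K -> K | `[< is_kaut phi >]}.

Definition pullback (t : curve_aut) : K -> K := val t.

Lemma pullbackP t : is_kaut (pullback t).
Proof. exact/asboolP/(valP t). Qed.

HB.instance Definition _ t := GRing.isLinear.Build k K K *:%R (pullback t)
  (let: And3 l _ _ := pullbackP t in l).
HB.instance Definition _ t := GRing.isMonoidMorphism.Build K K (pullback t)
  (let: And3 _ m _ := pullbackP t in m).

Definition mk_aut (phi : K -> K) (h : is_kaut phi) : curve_aut :=
  exist _ phi (introT (asboolP _) h).

Lemma aut1_subproof : is_kaut id.
Proof. by split=> //; exists id. Qed.

Lemma autM_subproof (s t : curve_aut) : is_kaut (pullback t \o pullback s).
Proof.
split; last exact: bij_comp (let: And3 _ _ b := pullbackP t in b)
                            (let: And3 _ _ b := pullbackP s in b).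
- by move=> a u v; rewrite /= !linearP.
- by split=> [|u v] /=; rewrite ?rmorph1 ?rmorphM.
Qed.

Definition aut_inv_fun (t : curve_aut) (z : K) : K :=
  xget 0 [set w | pullback t w = z].

Lemma pullback_inj t : injective (pullback t).
Proof. by have [_ _ /bij_inj] := pullbackP t. Qed.

Lemma aut_inv_funK t : cancel (aut_inv_fun t) (pullback t).
Proof.
move=> z; have [_ _ [g _ gK]] := pullbackP t.
by rewrite /aut_inv_fun; case: xgetP => // /(_ (g z)); rewrite /= gK.
Qed.

Lemma pullbackK t : cancel (pullback t) (aut_inv_fun t).
Proof. by move=> z; apply: (@pullback_inj t); rewrite aut_inv_funK. Qed.

Lemma autV_subproof (t : curve_aut) : is_kaut (aut_inv_fun t).
Proof.
have inj := @pullback_inj t; have iK := aut_inv_funK t.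
split; last by exists (pullback t); [exact: iK|exact: pullbackK].
- by move=> a u v; apply: inj; rewrite iK linearP /= !iK.
- split=> [|u v]; apply: inj; first by rewrite iK rmorph1.
  by rewrite iK rmorphM /= !iK.
Qed.

Definition aut1 := mk_aut aut1_subproof.
Definition autM s t := mk_aut (autM_subproof s t).
Definition autV t := mk_aut (autV_subproof t).

Fact autA : associative autM. Proof. by move=> r s t; apply: val_inj. Qed.
Fact aut1g : left_id aut1 autM. Proof. by move=> t; apply: val_inj. Qed.
Fact autg1 : right_id aut1 autM. Proof. by move=> t; apply: val_inj. Qed.
Fact autVg : left_inverse aut1 autV autM.
Proof. by move=> t; apply/val_inj/funext => z; exact: aut_inv_funK. Qed.
Fact autgV : right_inverse aut1 autV autM.
Proof. by move=> t; apply/val_inj/funext => z; exact: pullbackK. Qed.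

HB.instance Definition _ := isGroup.Build curve_aut autA aut1g autg1 autVg autgV.

(* The K-module M with scalars twisted by t^*. *)
Definition twist (t : curve_aut) (M : lmodType K) : Type := M.

Section Twist.
Variables (t : curve_aut) (M : lmodType K).
HB.instance Definition _ := GRing.Zmodule.copy (twist t M) M.

Definition twist_scale (a : K) (m : twist t M) : twist t M :=
  pullback t a *: (m : M).

Fact twist_scaleA a b m :
  twist_scale a (twist_scale b m) = twist_scale (a * b) m.
Proof. by rewrite /twist_scale scalerA rmorphM. Qed.
Fact twist_scale1 : left_id 1 twist_scale.
Proof. by move=> m; rewrite /twist_scale rmorph1 scale1r. Qed.
Fact twist_scaleDr : right_distributive twist_scale +%R.
Proof. by move=> a m n; exact: scalerDr. Qed.
Fact twist_scaleDl m : {morph twist_scale^~ m : a b / a + b}.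
Proof. by move=> a b; rewrite /twist_scale rmorphD; exact: scalerDl. Qed.

HB.instance Definition _ := GRing.Zmodule_isLmodule.Build K (twist t M)
  twist_scaleA twist_scale1 twist_scaleDr twist_scaleDl.
End Twist.

(* t^* on Omega: a d b |-> (t^* a) d (t^* b), see Omega_pullE. *)
Definition Omega_pull (t : curve_aut) (w : Omega_k K) : Omega_k K :=
  Omega_lift ((fun z => dK (pullback t z)) : K -> twist t (Omega K))
    (w : Omega K).

Lemma pull_derivation t :
  is_derivation ((fun z => dK (pullback t z)) : K -> twist t (Omega K)).
Proof.
have [dD dM dC] := dK_derivation K; split=> [z w|z w|c].
- by rewrite rmorphD dD.
- by rewrite rmorphM dM.
- by rewrite linearZ rmorph1 dC.
Qed.

Lemma Omega_pullE t (s : seq (K * K)) :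
  Omega_pull t (\sum_(p <- s) p.1 *: dK p.2 : Omega K) =
  (\sum_(p <- s) pullback t p.1 *: dK (pullback t p.2) : Omega K).
Proof.
have tD := pull_derivation t; rewrite /Omega_pull.
have L := Omega_lift_linear tD.
elim: s => [|p s IH]; last by rewrite !big_cons L IH Omega_lift_d.
by rewrite !big_nil; have := L (-1) 0 0; rewrite scaler0 addr0 scaleN1r addNr.
Qed.

End Automorphisms.

(* Closed points of the curve with function field K are the places of K/k,
   i.e. the valuation rings k <= O_P < K of K, equivalently the local rings of the
   closed points. *)

Section Curve.
Variables (k : fieldType) (K : fieldAlgType k).

Record place := Place {
  vring :> K -> Prop;
  vring_const : forall c : k, vring c%:A;
  vringD : forall u v, vring u -> vring v -> vring (u + v);
  vringM : forall u v, vring u -> vring v -> vring (u * v);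
  vring_val : forall u, vring u \/ vring u^-1;
  vring_proper : exists u, ~ vring u
}.

Definition zopen (U : set place) : Prop := U = set0 \/ finite_set (~` U).

Lemma zopenI U V : zopen U -> zopen V -> zopen (U `&` V).
Proof.
move=> [->|fU] [->|fV]; rewrite ?set0I ?setI0; try by left.
by right; rewrite setCI finite_setU.
Qed.

Lemma aut_place_subproof (t : curve_aut K) (P : place) :
  let O (z : K) := P (pullback t z) in
  [/\ forall c : k, O c%:A,
      forall u v, O u -> O v -> O (u + v),
      forall u v, O u -> O v -> O (u * v),
      forall u, O u \/ O u^-1 & exists u, ~ O u].
Proof.
split=> /= [c|u v|u v|u|].
- by rewrite linearZ rmorph1; exact: vring_const.
- by rewrite rmorphD; exact: vringD.
- by rewrite rmorphM; exact: vringM.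
- by rewrite fmorphV; exact: vring_val.
- have [u nPu] := vring_proper P; exists (pullback t^-1%g u).
  by rewrite -[pullback t _]/(pullback (t^-1 * t)%g u) mulVg.
Qed.

(* The action of an automorphism on closed points: f is regular at t(P) if and
   only if t^* f is regular at P. *)
Definition aut_place (t : curve_aut K) (P : place) : place :=
  let: And5 c d m v p := aut_place_subproof t P in Place c d m v p.

(* O_X and Omega_X are subsheaves of the constant sheaves K and Omega_K; the
   submodules below are their stalks. *)

Lemma stalkO_closed (P : place) :
  P 0 /\ forall (a : k) u v, P u -> P v -> P (a *: u + v).
Proof.
split=> [|a u v Pu Pv]; first by rewrite -(scale0r 1); exact: vring_const.
apply: vringD => //; rewrite -[u]mul1r scalerAl.
by apply: vringM => //; exact: vring_const.
Qed.

Definition stalkO (P : place) : submodule K := Submodule (stalkO_closed P).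

Lemma stalkOmega_closed (P : place) :
  let s (w : Omega_k K) := exists2 s : seq (K * K),
    (forall p, p \in s -> P p.1 /\ P p.2) &
    w = (\sum_(p <- s) p.1 *: dK p.2 : Omega K) in
  s 0 /\ forall a u v, s u -> s v -> s (a *: u + v).
Proof.
split=> [|a _ _ [s Ps ->] [t Pt ->]]; first by exists [::] => //; rewrite big_nil.
exists ([seq (a%:A * p.1, p.2) | p <- s] ++ t).
  move=> p; rewrite mem_cat => /orP[/mapP[q /Ps[Pq1 Pq2] ->]|/Pt //].
  by split=> //=; apply: vringM => //; exact: vring_const.
rewrite big_cat big_map /=; congr (_ + _); rewrite /GRing.scale /= /Omega_scale.
by rewrite scaler_sumr; apply: eq_bigr => p _; rewrite scalerA.
Qed.

Definition stalkOmega (P : place) : submodule (Omega_k K) :=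
  Submodule (stalkOmega_closed P).

(* Cochains of degree 0 and 1 for Cech cohomology, as the direct limit over
   open coverings (U_P)_P of X with P in U_P. Non-empty open subsets meet, and
   the restriction maps of a subsheaf F of a constant sheaf V between non-empty
   open subsets are inclusions, so the limit consists of families of elements
   of V. In degree 1, Cech (hyper)cohomology in this sense agrees with sheaf
   (hyper)cohomology. *)

Definition pointed_cover (U : place -> set place) : Prop :=
  forall P, zopen (U P) /\ U P P.

Lemma pointed_coverI U V : pointed_cover U -> pointed_cover V ->
  pointed_cover (fun P => U P `&` V P).
Proof.
by move=> cU cV P; split; [apply: zopenI; [case: (cU P)|case: (cV P)]|split;
  [case: (cU P)|case: (cV P)]].
Qed.

Section Cochains.
Variables (V : lmodType k) (F : place -> submodule V).

Definition sections (U : set place) (v : V) : Prop := forall P, U P -> F P v.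

Lemma sections_closed U :
  sections U 0 /\
  forall a u v, sections U u -> sections U v -> sections U (a *: u + v).
Proof.
split=> [P _|a u v su sv P UP]; first exact: (sm_closed (F P)).1.
by apply: (sm_closed (F P)).2; [exact: su|exact: sv].
Qed.

Definition global_sections : submodule V := Submodule (sections_closed setT).

Definition cech0 (g : place -> V) : Prop :=
  exists2 U, pointed_cover U & forall P, sections (U P) (g P).

Definition cech1 (f : place -> place -> V) : Prop :=
  exists2 U, pointed_cover U & forall P Q, sections (U P `&` U Q) (f P Q).

Lemma cover_setT : pointed_cover (fun=> setT).
Proof. by move=> P; split=> //; right; rewrite setCT. Qed.

Lemma cech0_closed :
  cech0 0 /\ forall a u v, cech0 u -> cech0 v -> cech0 (a *: u + v).
Proof.
split=> [|a u v [A cA uA] [B cB vB]].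
  by exists (fun=> setT) => [|P]; [exact: cover_setT|exact: (sections_closed _).1].
exists (fun P => A P `&` B P) => [|P]; first exact: pointed_coverI.
by apply: (sections_closed _).2 => Q [AQ BQ]; [exact: uA|exact: vB].
Qed.

Lemma cech1_closed :
  cech1 0 /\ forall a u v, cech1 u -> cech1 v -> cech1 (a *: u + v).
Proof.
split=> [|a u v [A cA uA] [B cB vB]].
  by exists (fun=> setT) => [|P Q]; [exact: cover_setT|exact: (sections_closed _).1].
exists (fun P => A P `&` B P) => [|P Q]; first exact: pointed_coverI.
by apply: (sections_closed _).2 => R [[? ?] [? ?]]; [exact: uA|exact: vB].
Qed.

Definition delta0 (g : place -> V) : place -> place -> V :=
  fun P Q => g Q - g P.

Definition cocycle1 (f : place -> place -> V) : Prop :=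
  forall P Q R, f Q R - f P R + f P Q = 0.

Lemma delta0_linear a u v : delta0 (a *: u + v) = a *: delta0 u + delta0 v.
Proof.
apply/funext => P; apply/funext => Q; rewrite /delta0 /=.
rewrite -[LHS]/(a *: u Q + v Q - (a *: u P + v P)).
rewrite -[RHS]/(a *: (u Q - u P) + (v Q - v P)).
by rewrite scalerBr opprD addrACA.
Qed.

Lemma cocycle1_linear a u v : cocycle1 u -> cocycle1 v -> cocycle1 (a *: u + v).
Proof.
move=> cu cv P Q R; rewrite -[LHS]/(a *: u Q R + v Q R -
  (a *: u P R + v P R) + (a *: u P Q + v P Q)).
rewrite opprD [X in X + _ = _]addrACA [LHS]addrACA cv addr0 -scalerN.
by rewrite -!scalerDr cu scaler0.
Qed.

Lemma Z1_closed : let s f := cech1 f /\ cocycle1 f in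
  s 0 /\ forall a u v, s u -> s v -> s (a *: u + v).
Proof.
split=> [|a u v [u1 cu] [v1 cv]]; split; first exact: cech1_closed.1.
- by move=> P Q R; rewrite -[LHS]/(0 - 0 + 0 : V) subrr addr0.
- exact: cech1_closed.2.
- exact: cocycle1_linear.
Qed.

Lemma B1_closed : let s f := exists2 g, cech0 g & f = delta0 g in
  s 0 /\ forall a u v, s u -> s v -> s (a *: u + v).
Proof.
split=> [|a _ _ [u u0 ->] [v v0 ->]].
  exists 0; first exact: cech0_closed.1.
  by apply/funext => P; apply/funext => Q; rewrite -[RHS]/(0 - 0 : V) subrr.
by exists (a *: u + v); [exact: cech0_closed.2|rewrite delta0_linear].
Qed.

Definition Z1 := Submodule Z1_closed.
Definition B1 := Submodule B1_closed.
Definition H1 : lmodType k := subquot Z1 B1.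

End Cochains.

Definition H1O : lmodType k := H1 stalkO.

Definition H0Omega : lmodType k := smtype (global_sections stalkOmega).

Definition genus (g : nat) : Prop :=
  exists phi : {linear H0Omega -> 'rV[k]_g}, bijective phi.

(* Degree 1 part of the total complex of the Cech double complex of
   d : O_X -> Omega_X. *)

Definition dRcochain : lmodType k :=
  ((place -> Omega_k K) * (place -> place -> K))%type.

Lemma dK_linear (a : k) (u v : K) :
  dK (a *: u + v) = a *: (dK u : Omega_k K) + dK v.
Proof.
have [dD dM dC] := dK_derivation K.
rewrite dD; congr (_ + _); rewrite -[u in LHS]mul1r scalerAl dM dC scaler0 addr0.
by [].
Qed.

Lemma Z1dR_closed : let s (c : dRcochain) :=
    [/\ cech0 stalkOmega c.1, Z1 stalkO c.2 &
        forall P Q, delta0 c.1 P Q = dK (c.2 P Q)] in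
  s 0 /\ forall a u v, s u -> s v -> s (a *: u + v).
Proof.
have d0 : dK (0 : K) = 0.
  by have [_ _ /(_ 0)] := dK_derivation K; rewrite scale0r.
split=> [|a u v [u1 u2 ud] [v1 v2 vd]]; split.
- exact: (cech0_closed _).1.
- exact: (Z1_closed _).1.
- by move=> P Q; rewrite -[LHS]/(0 - 0 : Omega_k K) subrr -[RHS]/(dK 0) d0.
- exact: (cech0_closed _).2.
- exact: (Z1_closed _).2.
- move=> P Q; rewrite delta0_linear.
  rewrite -[LHS]/(a *: delta0 u.1 P Q + delta0 v.1 P Q) ud vd.
  by rewrite -[RHS]/(dK (a *: u.2 P Q + v.2 P Q)) dK_linear.
Qed.

Lemma B1dR_closed : let s (c : dRcochain) := exists2 g, cech0 stalkO g &
    c.1 = (fun P => dK (g P)) /\ c.2 = delta0 g in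
  s 0 /\ forall a u v, s u -> s v -> s (a *: u + v).
Proof.
have d0 : dK (0 : K) = 0.
  by have [_ _ /(_ 0)] := dK_derivation K; rewrite scale0r.
split=> [|a u v [f f0 [u1 u2]] [g g0 [v1 v2]]].
  exists 0; first exact: (cech0_closed _).1.
  split; first by apply/funext => P; rewrite -[RHS]/(dK 0) d0.
  by apply/funext => P; apply/funext => Q; rewrite -[RHS]/(0 - 0 : K) subrr.
exists (a *: f + g); first exact: (cech0_closed _).2.
split; last by rewrite delta0_linear -u2 -v2.
apply/funext => P; rewrite -[RHS]/(dK (a *: f P + g P)) dK_linear.
by rewrite -[LHS]/(a *: u.1 P + v.1 P) u1 v1.
Qed.

Definition Z1dR := Submodule Z1dR_closed.
Definition B1dR := Submodule B1dR_closed.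
Definition H1dR : lmodType k := subquot Z1dR B1dR.

Definition H1dR_proj : H1dR -> H1O :=
  @sqmap _ _ _ Z1dR B1dR (Z1 stalkO) (B1 stalkO) snd.

Definition pull_O (t : curve_aut K) (f : place -> place -> K) :
    place -> place -> K :=
  fun P Q => pullback t (f (aut_place t P) (aut_place t Q)).

Definition pull_dR (t : curve_aut K) (c : dRcochain) : dRcochain :=
  ((fun P => Omega_pull t (c.1 (aut_place t P))), pull_O t c.2).

Definition H1O_pull (t : curve_aut K) : H1O -> H1O :=
  @sqmap _ _ _ (Z1 stalkO) (B1 stalkO) (Z1 stalkO) (B1 stalkO) (pull_O t).

Definition H1dR_pull (t : curve_aut K) : H1dR -> H1dR :=
  @sqmap _ _ _ Z1dR B1dR Z1dR B1dR (pull_dR t).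

Lemma H1dR_projE (c : dRcochain) : Z1dR c ->
  H1dR_proj (sqclass Z1dR B1dR c) = sqclass (Z1 stalkO) (B1 stalkO) c.2.
Proof.
apply: sqmap_class => [//|v [] //|v [g g0 [_ vE]]].
by exists g.
Qed.

Lemma zopen_preimage (t : curve_aut K) U :
  zopen U -> zopen [set P | U (aut_place t P)].
Proof.
have place_inj : injective (aut_place t).
  move=> P Q PQ; have eqv z : P z <-> Q z.
    have -> : z = pullback t (pullback t^-1%g z).
      by rewrite -[RHS]/(pullback (t^-1 * t)%g z) mulVg.
    have := congr1 (fun O : place => O (pullback t^-1%g z)) PQ.
    by rewrite /aut_place; do 2![case: aut_place_subproof => ? ? ? ? ?] => /= ->.
  have {}eqv : vring P = vring Q by apply/funext => z; apply/propext.
  case: P Q eqv {PQ} => O c1 d1 m1 v1 p1 [O' c2 d2 m2 v2 p2] /= E.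
  case: _ / E c2 d2 m2 v2 p2 => c2 d2 m2 v2 p2.
  by congr Place; apply: Prop_irrelevance.
case=> [->|fU]; [by left|right].
have : finite_set (aut_place t @^-1` (~` U)).
  by apply: finite_preimage => // P Q _ _; exact: place_inj.
by [].
Qed.

Lemma aut_placeE t P z : aut_place t P z = P (pullback t z).
Proof. by rewrite /aut_place; case: aut_place_subproof. Qed.

Lemma pull_cover t U : pointed_cover U ->
  pointed_cover (fun P => [set Q | U (aut_place t P) (aut_place t Q)]).
Proof.
by move=> cU P; split; [apply: zopen_preimage; case: (cU (aut_place t P))|
  case: (cU (aut_place t P))].
Qed.

Lemma pull_stalkOmega t P (w : Omega_k K) :
  stalkOmega (aut_place t P) w -> stalkOmega P (Omega_pull t w).
Proof.
case=> s sP ->; rewrite Omega_pullE.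
exists [seq (pullback t p.1, pullback t p.2) | p <- s]; last by rewrite big_map.
by move=> p /mapP[q /sP]; rewrite !aut_placeE => -[? ?] ->.
Qed.

Lemma pull_cech0 t g : cech0 stalkO g ->
  cech0 stalkO (fun P => pullback t (g (aut_place t P))).
Proof.
case=> U cU gU; exists (fun P => [set Q | U (aut_place t P) (aut_place t Q)]).
  exact: pull_cover.
by move=> P Q /gU /=; rewrite aut_placeE.
Qed.

Lemma pull_Z1 t f : Z1 stalkO f -> Z1 stalkO (pull_O t f).
Proof.
case=> [[U cU fU] fZ]; split; last first.
  by move=> P Q R; rewrite /pull_O -rmorphB -rmorphD fZ rmorph0.
exists (fun P => [set Q | U (aut_place t P) (aut_place t Q)]).
  exact: pull_cover.
by move=> P Q R [UP UQ]; have := fU _ _ _ (conj UP UQ); rewrite /= aut_placeE.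
Qed.

Lemma pull_B1 t f : B1 stalkO f -> B1 stalkO (pull_O t f).
Proof.
case=> g g0 ->; exists (fun P => pullback t (g (aut_place t P))).
  exact: pull_cech0.
by apply/funext => P; apply/funext => Q; rewrite /pull_O /delta0 rmorphB.
Qed.

Lemma pull_OB t : {morph pull_O t : u v / u - v}.
Proof.
move=> u v; apply/funext => P; apply/funext => Q.
by rewrite /pull_O -[LHS]/(pullback t (u _ _ - v _ _)) rmorphB.
Qed.

Lemma H1O_pullE t f : Z1 stalkO f ->
  H1O_pull t (sqclass (Z1 stalkO) (B1 stalkO) f) =
  sqclass (Z1 stalkO) (B1 stalkO) (pull_O t f).
Proof.
apply: sqmap_class; [exact: pull_OB|exact: pull_Z1|exact: pull_B1].
Qed.

Lemma Omega_pull_d t z : Omega_pull t (@dK k K z) = dK (pullback t z).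
Proof. exact: Omega_lift_d (pull_derivation t) z. Qed.

Lemma Omega_pullB (t : curve_aut K) (u v : Omega_k K) :
  Omega_pull t (u - v) = Omega_pull t u - Omega_pull t v.
Proof.
rewrite /Omega_pull.
have -> : u - v = (-1) *: (v : Omega K) + (u : Omega K).
  by rewrite scaleN1r addrC.
rewrite (Omega_lift_linear (pull_derivation t)) scaleN1r.
exact: addrC.
Qed.

Lemma H1dR_pullE t c : Z1dR c ->
  H1dR_pull t (sqclass Z1dR B1dR c) = sqclass Z1dR B1dR (pull_dR t c).
Proof.
apply: sqmap_class.
- move=> u v; congr (_, _); last exact: pull_OB.
  by apply/funext => P; exact: Omega_pullB.
- move=> v [[U cU v1] v2 vd]; split; last 1 first.
  + move=> P Q; have := vd (aut_place t P) (aut_place t Q).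
    move=> /(congr1 (Omega_pull t)).
    by rewrite Omega_pull_d /delta0 Omega_pullB.
  + exists (fun P => [set Q | U (aut_place t P) (aut_place t Q)]).
      exact: pull_cover.
    by move=> P Q UQ; apply: pull_stalkOmega; exact: v1.
  + exact: pull_Z1.
- move=> v [g g0 [v1 v2]]; exists (fun P => pullback t (g (aut_place t P))).
    exact: pull_cech0.
  split; first by apply/funext => P; rewrite /= v1 Omega_pull_d.
  by apply/funext => P; apply/funext => Q; rewrite /= v2 /pull_O /delta0 rmorphB.
Qed.

Definition generated (A : set (curve_aut K)) : set (curve_aut K) :=
  [set t | forall H : {pred curve_aut K}, group_closed H ->
    (forall s, A s -> s \in H) -> t \in H].

Definition hodge_deRham_splits (G : set (curve_aut K)) : Prop :=
  exists s : {linear H1O -> H1dR},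
    (forall c, H1dR_proj (s c) = c) /\
    (forall t, G t -> forall c, s (H1O_pull t c) = H1dR_pull t (s c)).

Definition transcendental (x : K) : Prop :=
  forall q : {poly k}, horner_alg x q = 0 -> q = 0.

Definition horner2 (x y : K) (q : {poly {poly k}}) : K :=
  (map_poly (horner_alg x) q).[y].

Definition generated_by (x y : K) : Prop := forall z : K,
  exists u v : {poly {poly k}}, horner2 x y v != 0 /\ z = horner2 x y u / horner2 x y v.

(* pi o t = tbar o pi with tbar : x |-> x + a, read on function fields; pi
   corresponds to the inclusion of k(x) in K. *)
Definition induces_translation (t : curve_aut K) (x : K) (a : k) : Prop :=
  pullback t x = x + a%:A.

End Curve.

(* Main.v *)
Require Import Defs.
From mathcomp Require Import all_boot all_algebra.
From mathcomp Require Import boolp classical_sets functions cardinality.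
From mathcomp Require Import ring zify.

(* Write y^2 = f(x) with f of degree 2m + 1 and set z0 = y / x^m, which has a
   simple pole at the point at infinity and represents a class of H^1(O). After
   replacing tau by its square sigma, one has sigma y = y and
   sigma x = x + b with b = 2a, so that f(x + b) = f(x); comparing coefficients,
   2m + 1 = 0 in k. Since sigma z0 - z0 is regular at infinity, the class of z0
   is invariant. A splitting would lift it to a rational differential
   omega = h dx/y with sigma omega = omega, regular at all finite points, such
   that omega + d z0 is regular at infinity. The first condition says
   h = h0(x) + h1(x) y with h0, h1 polynomials, the second one that h0 has
   degree m and leading coefficient -1/2. But h0(x + b) = h0(x) forces m = 0 in
   k, a contradiction with 2m + 1 = 0.

   No theory of valuations or of differentials on curves is needed beyond the
   following. The local ring at a point (r, s) of the affine model is a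
   valuation ring by an explicit computation with fractions; the vector field
   D = y d/dx, dual to dx/y, preserves it, so that h = D(omega) is regular
   whenever omega is. The point at infinity is the origin of the chart
   t = 1/x, w = y / x^(m+1), to which the same results apply. *)

Set Implicit Arguments.
Unset Strict Implicit.
Unset Printing Implicit Defensive.

Import GRing.Theory.
Local Open Scope ring_scope.

(** * Roots of polynomials over the base field *)

Lemma root_factor (k : fieldType) (q : {poly k}) (r : k) :
  root q r -> exists q1, q = q1 * ('X - r%:P).
Proof. by move=> /factor_theorem. Qed.

(** Division by the gcd leaves coprime polynomials, which have no common root. *)
Lemma fraction_at (k : fieldType) (n c : {poly k}) (r : k) : c != 0 ->
  exists n1 c1, [/\ n * c1 = c * n1, c1 != 0 & ~~ root n1 r \/ ~~ root c1 r].
Proof.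
move=> c0; have [gn gc] := (dvdp_gcdl n c, dvdp_gcdr n c).
exists (n %/ gcdp n c), (c %/ gcdp n c); split.
- have := divpK gc; have := divpK gn.
  by move: (gcdp n c) => e; move: (n %/ e) (c %/ e) => a b <- <-; ring.
- by rewrite dvdp_div_eq0.
- have [rn|] := boolP (root (n %/ gcdp n c) r); [right|by left].
  apply: (coprimep_root _ rn).
  by rewrite coprimep_div_gcd // c0 orbT.
Qed.

Lemma sqrt_closed (k : closedFieldType) (c : k) : exists s, s ^+ 2 = c.
Proof.
have /closed_rootP[s] : size ('X^2 - c%:P) != 1.
  by rewrite size_XnsubC.
by rewrite /root !hornerE subr_eq0 => /eqP; exists s.
Qed.

(** * Places: valuation rings and their maximal ideals *)

Section PlaceTheory.
Variables (k : fieldType) (K : fieldAlgType k) (P : place K).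
Implicit Types z u v : K.

Lemma place_ext (Q : place K) : (forall z, P z <-> Q z) -> P = Q.
Proof.
move=> PQ; have {PQ} : vring P = vring Q by apply/funext => z; apply/propext.
case: P Q => O c1 d1 m1 v1 p1 [O' c2 d2 m2 v2 p2] /= E.
case: _ / E c2 d2 m2 v2 p2 => c2 d2 m2 v2 p2.
by congr Place; exact: Prop_irrelevance.
Qed.

Lemma vring0 : P 0. Proof. by rewrite -(scale0r 1); exact: vring_const. Qed.

Lemma vring1 : P 1. Proof. by rewrite -(scale1r 1); exact: vring_const. Qed.

Lemma vringN u : P u -> P (- u).
Proof.
by move=> Pu; rewrite -mulN1r -(scaleN1r 1); apply: vringM => //;
  exact: vring_const.
Qed.

Lemma vringB u v : P u -> P v -> P (u - v).
Proof. by move=> Pu Pv; apply: vringD => //; exact: vringN. Qed.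

Lemma vringX u n : P u -> P (u ^+ n).
Proof.
by move=> Pu; elim: n => [|n IH]; [exact: vring1|rewrite exprS; exact: vringM].
Qed.

(** An instance of integral closedness: if [u^-1] is regular, so is [u = u^2 / u]. It gives
    regularity of [y] from that of [f(x)]. *)
Lemma vring_sqrt u : P (u ^+ 2) -> P u.
Proof.
have [->|u0] := eqVneq u 0; first by rewrite expr0n.
have [//|Pu' P2] := vring_val P u; rewrite -(mulfK u0 u) -expr2.
exact: vringM.
Qed.

Lemma vring_horner_alg x q : P x -> P (horner_alg x q).
Proof.
move=> Px; elim/poly_ind: q => [|q c IH]; first by rewrite rmorph0;
  exact: vring0.
rewrite rmorphD rmorphM /= horner_algX horner_algC.
by apply: vringD; [exact: vringM|exact: vring_const].
Qed.

(* Membership in the maximal ideal of P; the disjunct is needed as 0^-1 = 0. *)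
Definition pmax z := z = 0 \/ ~ P z^-1.

Lemma pmax_notV z : z != 0 -> pmax z -> ~ P z^-1.
Proof. by move=> z0 []// zE; rewrite zE eqxx in z0. Qed.

Lemma pmax_vring z : pmax z -> P z.
Proof. by case=> [->|nP]; [exact: vring0|have [|/nP] := vring_val P z]. Qed.

Lemma pmaxM u v : P u -> pmax v -> pmax (u * v).
Proof.
move=> Pu Mv; have [->|u0] := eqVneq u 0; first by rewrite mul0r; left.
case: Mv => [->|nPv]; first by rewrite mulr0; left.
right=> Puv; apply: nPv; have -> : v^-1 = u * (u * v)^-1.
  by rewrite invfM mulVKf.
exact: vringM.
Qed.

(** One of [u / v] and [v / u] is regular, so the sum is a regular multiple of [v] or of [u]. *)
Lemma pmaxD u v : pmax u -> pmax v -> pmax (u + v).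
Proof.
have [->|u0] := eqVneq u 0; first by rewrite add0r.
have [->|v0] := eqVneq v 0; first by rewrite addr0.
move=> Mu Mv; have [Puv|Pvu] := vring_val P (u / v).
  have -> : u + v = (u / v + 1) * v by rewrite mulrDl mul1r divfK.
  by apply: pmaxM Mv; apply: vringD => //; exact: vring1.
have -> : u + v = (1 + (u / v)^-1) * u by rewrite invf_div mulrDl mul1r divfK.
by apply: pmaxM Mu; apply: vringD => //; exact: vring1.
Qed.

Lemma pmaxN u : pmax u -> pmax (- u).
Proof. by rewrite -mulN1r; apply: pmaxM; apply: vringN; exact: vring1. Qed.

Lemma pmaxB u v : pmax u -> pmax v -> pmax (u - v).
Proof. by move=> Mu Mv; apply: pmaxD => //; exact: pmaxN. Qed.

Lemma pmax_const (c : k) : c != 0 -> ~ pmax c%:A.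
Proof.
move=> c0 /pmax_notV; rewrite scaler_eq0 oner_eq0 orbF => /(_ c0); apply.
by rewrite invrZ ?unitfE ?oner_eq0 // invr1; exact: vring_const.
Qed.

Lemma pmax_prime u v : pmax (u * v) -> P u -> P v -> pmax u \/ pmax v.
Proof.
move=> Muv Pu Pv; have [?|Mu] := EM (pmax u); first by left.
have [?|Mv] := EM (pmax v); first by right.
have inv w : ~ pmax w -> w != 0 /\ P w^-1.
  move=> Mw; split; first by apply/eqP => w0; apply: Mw; left.
  by have [//|nP] := EM (P w^-1); case: Mw; right.
have [[u0 Pu'] [v0 Pv']] := (inv u Mu, inv v Mv).
case: (pmax_notV (mulf_neq0 u0 v0) Muv); rewrite invfM; exact: vringM.
Qed.

Lemma pmax_vringB z (c : k) : pmax (z - c%:A) -> P z.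
Proof.
move=> /pmax_vring Pz; rewrite -[z](subrK c%:A).
by apply: vringD => //; exact: vring_const.
Qed.

Lemma pmax_horner_alg x r q :
  pmax (x - r%:A) -> pmax (horner_alg x q - q.[r]%:A).
Proof.
move=> Mx; have /root_factor[q1 qE] : root (q - q.[r]%:P) r.
  by rewrite /root !hornerE subrr.
have -> : horner_alg x q - q.[r]%:A = horner_alg x q1 * (x - r%:A).
  rewrite -(horner_algC x) -rmorphB qE rmorphM rmorphB /= horner_algX.
  by rewrite horner_algC.
by apply: pmaxM (Mx); apply: vring_horner_alg; exact: pmax_vringB Mx.
Qed.

End PlaceTheory.

(** * Plane models [y^2 = f(x)] and their local rings *)

Section Charts.
Variables (k : closedFieldType) (K : fieldAlgType k).
Implicit Types (x y z : K) (f c : {poly k}) (u v : {poly k} * {poly k}).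

Definition affine x y u : K := horner_alg x u.1 + horner_alg x u.2 * y.

(** [K] has basis [1, y] over [k(x)]. Elements [u.1(x) + u.2(x) y] of the coordinate ring are
    encoded as pairs of polynomials; for [u.2 = 0] freeness is the transcendence of [x]. *)
Record chart x y f : Prop := Chart {
  chart_eqn : y ^+ 2 = horner_alg x f;
  chart_free : forall u, affine x y u = 0 -> u = 0;
  chart_gen : forall z, exists u c, c != 0 /\ z * horner_alg x c = affine x y u
}.

Definition amul f u v : {poly k} * {poly k} :=
  (u.1 * v.1 + u.2 * v.2 * f, u.1 * v.2 + u.2 * v.1).

Definition aval (r s : k) u : k := u.1.[r] + u.2.[r] * s.

(* The local ring of the affine curve at [(r, s)]. *)
Definition at_point x y r s z :=
  exists u v, aval r s v != 0 /\ z * affine x y v = affine x y u.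

Section Chart.
Variables (x y : K) (f : {poly k}).
Hypothesis C : chart x y f.
Hypothesis two0 : 2 != 0 :> k.
Let y2 := chart_eqn C.

Local Notation hx := (horner_alg x).
Local Notation aff := (affine x y).

Lemma affineM u v : aff (amul f u v) = aff u * aff v.
Proof.
rewrite /affine /amul /= !rmorphD !rmorphM /= -y2; ring.
Qed.

Lemma avalM r s u v : s ^+ 2 = f.[r] ->
  aval r s (amul f u v) = aval r s u * aval r s v.
Proof. by move=> s2; rewrite /aval /= !hornerE -s2; ring. Qed.

Lemma affine_inj : injective aff.
Proof.
move=> u v /eqP; rewrite -subr_eq0 => /eqP uv.
have /(chart_free C) [u1 u2] : aff (u.1 - v.1, u.2 - v.2) = 0.
  by rewrite -uv /affine /= !rmorphB /=; ring.
by case: u v u1 u2 {uv} => [u1 u2] [v1 v2] /= /subr0_eq -> /subr0_eq ->.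
Qed.

Lemma affineC c : aff (c, 0) = hx c.
Proof. by rewrite /affine /= rmorph0 mul0r addr0. Qed.

Lemma chart_inj : injective hx.
Proof. by move=> u v; rewrite -!affineC => /affine_inj[]. Qed.

Lemma hx_eq0 c : (hx c == 0) = (c == 0).
Proof. by rewrite -(inj_eq chart_inj) rmorph0. Qed.

Lemma affine_eq0 u : (aff u == 0) = (u == 0).
Proof.
by apply/eqP/eqP => [/(chart_free C)//|->]; rewrite affineC rmorph0.
Qed.

Lemma aval_neq0 r s u : aval r s u != 0 -> aff u != 0.
Proof.
rewrite affine_eq0; apply: contraNneq => ->.
by rewrite /aval !horner0 mul0r addr0.
Qed.

Lemma chart_y_neq0 : y != 0.
Proof.
have: aff (0, 1) != 0 by rewrite affine_eq0; apply/eqP => -[/eqP];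
  rewrite oner_eq0.
by rewrite /affine rmorph0 rmorph1 add0r mul1r.
Qed.

(** A common linear factor of the denominator and of both coordinates can be cancelled, which lowers
    the degree of the denominator; this is repeated until none is left. *)
Lemma reduced_rep z : exists u c, [/\ c != 0, z * hx c = aff u &
  forall r, root c r -> ~~ (root u.1 r && root u.2 r)].
Proof.
have [u [c [c0 zc]]] := chart_gen C z.
have [n] := ubnP (size c); elim: n => // n IH in u c c0 zc * => cn.
have [|H] := EM (exists r, [/\ root c r, root u.1 r & root u.2 r]); last first.
  exists u, c; split=> // r cr; apply/negP => /andP[ur1 ur2].
  by apply: H; exists r.
case=> r [/root_factor[c1 cE] /root_factor[u1 u1E] /root_factor[u2 u2E]].
apply: (IH (u1, u2) c1).
- by apply: contraNneq c0; rewrite cE => ->; rewrite mul0r.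
- have X0 : hx ('X - r%:P) != 0 by rewrite hx_eq0 polyXsubC_eq0.
  apply: (mulIf X0); rewrite -mulrA -rmorphM -cE zc /affine u1E u2E /=.
  by rewrite !rmorphM /=; ring.
- move: cn; rewrite cE size_Mmonic ?monicXsubC ?size_XsubC ?addn2 //.
  by apply: contraNneq c0; rewrite cE => ->; rewrite mul0r.
Qed.

(** If a reduced denominator vanished at [r], the numerator [u] would vanish at both points above
    [r]. Hence [u.1] vanishes at [r], [u.2] does not, and [s = 0]. In that ramified case, the
    coefficient of [y] in [u v1 = c u1] contradicts the non-vanishing of [v1]. *)
Lemma at_point_conj r s z : s ^+ 2 = f.[r] ->
  at_point x y r s z -> at_point x y r (- s) z ->
  exists u c, c.[r] != 0 /\ z * hx c = aff u.
Proof.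
move=> s2 [u1 [v1 [v1r zv1]]] [u2 [v2 [v2r zv2]]].
have [u [c [c0 zc red]]] := reduced_rep z; exists u, c; split=> //.
have [|//] := boolP (root c r); rewrite /root => cr.
(* In the coordinate ring [u v' = c u'], and [c] vanishes at [r]: the value at the point gives the
   first equation, the coefficient of [y] the second. *)
have Z s' u' v' : s' ^+ 2 = f.[r] -> aval r s' v' != 0 ->
    z * aff v' = aff u' ->
    aval r s' u = 0 /\ u.1.[r] * v'.2.[r] + u.2.[r] * v'.1.[r] = 0.
  move=> s'2 v'r zv'.
  have E : amul f u v' = amul f (c, 0) u'.
    apply: affine_inj; rewrite !affineM -zv' -zc affineC; ring.
  split.
    apply: (mulIf v'r); rewrite -avalM // E avalM //.
    by rewrite /aval /= (eqP cr) horner0; ring.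
  have := congr1 (fun w => w.2.[r]) E.
  by rewrite /= !hornerE /= (eqP cr) => ->; ring.
have [a1 b1] := Z s u1 v1 s2 v1r zv1.
have ns2 : (- s) ^+ 2 = f.[r] by rewrite sqrrN.
have [a2 b2] := Z (- s) u2 v2 ns2 v2r zv2.
have ur1 : u.1.[r] = 0.
  apply: (mulfI two0); rewrite mulr0 -[RHS](addr0 0) -{1}a1 -a2 /aval; ring.
have ur2 : u.2.[r] != 0.
  by have := red r cr; rewrite /root ur1 eqxx.
have s0 : s = 0.
  by apply: (mulfI ur2); move: a1; rewrite /aval ur1 add0r mulr0.
move: b1 v1r; rewrite /aval ur1 s0 mul0r mulr0 add0r addr0 => /eqP.
by rewrite mulf_eq0 (negPf ur2) => /= ->.
Qed.

(** Only the case where numerator and denominator of a reduced [z = u / c] both vanish at the point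
    needs work; there the numerator is replaced by its norm to [k[x]]. *)
Lemma at_point_val r s z : s ^+ 2 = f.[r] ->
  f.[r] != 0 \/ f^`().[r] != 0 ->
  at_point x y r s z \/ at_point x y r s z^-1.
Proof.
move=> s2 smooth; have [->|z0] := eqVneq z 0.
  left; exists (0, 0), (1, 0); rewrite /aval /= !hornerE oner_eq0.
  by rewrite affineC rmorph0.
have [u [c [c0 zc red]]] := reduced_rep z.
have inv v w : aval r s w != 0 -> z * aff v = aff w -> at_point x y r s z^-1.
  by move=> wr zv; exists v, w; rewrite -zv mulKf.
have [cr|cr] := boolP (root c r); last first.
  left; exists u, (c, 0); rewrite affineC /aval /= horner0 mul0r addr0.
  by split.
have [ur|ur] := eqVneq (aval r s u) 0; last first.
  by right; apply: (inv (c, 0) u) => //; rewrite affineC.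
(* The conjugate and the norm of [u], so that [z = n / (c ub)] with [n] and [c] in [k[x]]. *)
pose ub := (u.1, - u.2); pose n := u.1 ^+ 2 - u.2 ^+ 2 * f.
have zn : z * hx c * aff ub = hx n.
  rewrite zc -affineM -affineC /amul /ub /n /=; congr (aff _).
  by congr (_, _); ring.
suff red1 : exists n1 c1, [/\ z * hx c1 * aff ub = hx n1
   & ~~ root n1 r \/ ~~ root c1 r && (aval r s ub != 0)].
  have [n1 [c1 [zn1 [n1r|/andP[c1r ubr]]]]] := red1.
    right; apply: (inv (amul f (c1, 0) ub) (n1, 0)).
      by rewrite /aval /= horner0 mul0r addr0.
    by rewrite affineM !affineC mulrA.
  left; exists (n1, 0), (amul f (c1, 0) ub); rewrite affineM !affineC.
  by rewrite avalM // mulf_neq0 ?mulrA // /aval /= horner0 mul0r addr0.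
have cancel c1 n1 : n * c1 = c * n1 -> z * hx c1 * aff ub = hx n1.
  move=> E; have c0' : hx c != 0 by rewrite hx_eq0.
  by apply: (mulfI c0'); rewrite -rmorphM -E rmorphM /= -zn; ring.
have [ubr|ubr] := eqVneq (aval r s ub) 0; last first.
  have [n1 [c1 [E c10 n1r]]] := fraction_at n r c0.
  exists n1, c1; split; first exact: cancel.
  by rewrite andbT.
have ur1 : u.1.[r] = 0.
  apply: (mulfI two0); rewrite mulr0 -[RHS](addr0 0) -{1}ur -ubr /aval /=.
  by rewrite hornerN; ring.
have ur2 : u.2.[r] != 0.
  by have := red r cr; rewrite /root ur1 eqxx.
have s0 : s = 0.
  by apply: (mulfI ur2); move: ur; rewrite /aval ur1 add0r mulr0.
have fr : f.[r] = 0 by rewrite -s2 s0 expr0n.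
have /root_factor[f1 fE] : root f r by apply/eqP.
have /root_factor[u1 u1E] : root u.1 r by apply/eqP.
have /root_factor[c1 cE] := cr.
have f1r : f1.[r] != 0.
  case: smooth; rewrite ?fr ?eqxx // fE derivM derivXsubC !hornerE subrr.
  by rewrite mulr0 add0r.
(* At this branch point [f = f1 (X - r)] with [f1] non-zero at [r] by smoothness, so [n] has a
   simple zero at [r]. Cancelling [X - r] against [c] leaves a numerator that does not vanish,
   whence [z^-1] is regular. *)
exists (u1 ^+ 2 * ('X - r%:P) - u.2 ^+ 2 * f1), c1; split.
  by apply: cancel; rewrite /n u1E cE {1}fE; ring.
left; rewrite /root !hornerE subrr mulr0 sub0r oppr_eq0 mulf_neq0 //.
by rewrite expf_neq0.
Qed.

Lemma affineD u v : aff (u + v) = aff u + aff v.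
Proof. by rewrite /affine /= !rmorphD /=; ring. Qed.

Lemma place_at r s : s ^+ 2 = f.[r] -> f.[r] != 0 \/ f^`().[r] != 0 ->
  exists P : place K, forall z, P z <-> at_point x y r s z.
Proof.
move=> s2 smooth; suff [c d m v p] : [/\ forall c : k, at_point x y r s c%:A,
    forall z w, at_point x y r s z -> at_point x y r s w ->
      at_point x y r s (z + w),
    forall z w, at_point x y r s z -> at_point x y r s w ->
      at_point x y r s (z * w),
    forall z, at_point x y r s z \/ at_point x y r s z^-1
  & exists z, ~ at_point x y r s z] by exists (Place c d m v p).
split.
- move=> c; exists (c%:P, 0), (1, 0); rewrite !affineC rmorph1 mulr1
    horner_algC.
  by split=> //; rewrite /aval /= !hornerE oner_eq0.
- move=> z w [u1 [v1 [v1r zE]]] [u2 [v2 [v2r wE]]].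
  exists (amul f u1 v2 + amul f u2 v1), (amul f v1 v2).
  by rewrite avalM // mulf_neq0 // affineD !affineM -zE -wE; split=> //; ring.
- move=> z w [u1 [v1 [v1r zE]]] [u2 [v2 [v2r wE]]].
  exists (amul f u1 u2), (amul f v1 v2).
  by rewrite avalM // mulf_neq0 // !affineM -zE -wE; split=> //; ring.
- by move=> z; exact: at_point_val.
- exists (x - r%:A)^-1 => -[u [v [vr E]]]; move: vr.
  have xr : x - r%:A = aff ('X - r%:P, 0).
    by rewrite affineC rmorphB /= horner_algX horner_algC.
  have xr0 : x - r%:A != 0.
    by rewrite xr affineC hx_eq0 polyXsubC_eq0.
  suff -> : v = amul f ('X - r%:P, 0) u.
    by rewrite avalM // /aval /= !hornerE subrr !(mul0r, add0r) eqxx.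
  by apply: affine_inj; rewrite affineM -E -xr mulVKf.
Qed.

(** Affine functions are congruent to their values modulo the maximal ideal of [R], so [R] contains
    the local ring. If [z] in [R] were not in the local ring, [z^-1] would be in it and vanish at
    the point, hence lie in the maximal ideal of [R], which is absurd. *)
Lemma place_over_unique r s (P R : place K) : s ^+ 2 = f.[r] ->
  (forall z, P z <-> at_point x y r s z) ->
  pmax R (x - r%:A) -> pmax R (y - s%:A) -> R = P.
Proof.
move=> s2 PE Rx Ry.
have x_reg := pmax_vringB Rx.
have y_reg := pmax_vringB Ry.
have u_reg u : R (aff u).
  by apply: vringD; [|apply: vringM => //]; exact: vring_horner_alg.
have u_val u : pmax R (aff u - (aval r s u)%:A).
  have -> : aff u - (aval r s u)%:A = (hx u.1 - u.1.[r]%:A) +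
      (y * (hx u.2 - u.2.[r]%:A) + u.2.[r]%:A * (y - s%:A)).
    by rewrite /affine /aval scalerDl -scalerA -[_ *: s%:A]mulr_algl; ring.
  apply: pmaxD; first exact: pmax_horner_alg.
  apply: pmaxD; apply: pmaxM => //; first exact: pmax_horner_alg.
  exact: vring_const.
have v_unit v : aval r s v != 0 -> R (aff v)^-1.
  move=> vr; have [//|] := pselect (R (aff v)^-1) => nR.
  case: (@pmax_const _ _ R (aval r s v)) => //.
  have -> : (aval r s v)%:A = aff v - (aff v - (aval r s v)%:A) by ring.
  by apply: pmaxB => //; right.
apply: place_ext => z; rewrite PE; split; last first.
  case=> u [v [vr zE]]; have -> : z = aff u * (aff v)^-1.
    by rewrite -zE mulfK // (aval_neq0 vr).
  by apply: vringM; [exact: u_reg|exact: v_unit].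
have [z0|z0] := eqVneq z 0.
  by move=> _; apply/PE; rewrite z0; exact: vring0.
move=> Rz; have [/PE//|/PE[u [v [vr zE]]]] := vring_val P z.
have vE : aff v = z * aff u by rewrite -zE mulVKf.
have [ur|ur] := eqVneq (aval r s u) 0; last by exists v, u.
have /pmax_notV : pmax R z^-1; last by rewrite invrK invr_eq0 => /(_ z0)[].
have -> : z^-1 = (aff v)^-1 * aff u by rewrite -zE mulrC mulfK // (aval_neq0
  vr).
apply: pmaxM; first exact: v_unit.
by have := u_val u; rewrite ur scale0r subr0.
Qed.

(** For [s^2 = f(r)], the product [(y - s) (y + s) = f(x) - f(r)] lies in the maximal ideal, so only
    the places at [(r, s)] and [(r, -s)] occur. Such finiteness statements provide the Zariski-open
    sets of the Cech coverings. *)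
Lemma finite_places_over r : f.[r] != 0 \/ f^`().[r] != 0 ->
  finite_set [set R : place K | ~ R (x - r%:A)^-1]%classic.
Proof.
move=> smooth; have [s s2] := sqrt_closed f.[r].
have ns2 : (- s) ^+ 2 = f.[r] by rewrite sqrrN.
have [P PE] := place_at s2 smooth; have [Q QE] := place_at ns2 smooth.
apply: (@sub_finite_set _ _ [set P; Q]%classic); last exact: finite_set2.
move=> R /= nR; have Rx : pmax R (x - r%:A) by right.
have x_reg := pmax_vringB Rx.
have y_reg : R y by apply: vring_sqrt; rewrite y2; exact: vring_horner_alg.
have [|||H|H] := @pmax_prime _ _ R (y - s%:A) (y + s%:A).
- have -> : (y - s%:A) * (y + s%:A) = hx f - f.[r]%:A.
    by rewrite -y2 -s2 expr2 -scalerA -[s *: s%:A]mulr_algl; ring.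
  exact: pmax_horner_alg.
- by apply: vringB => //; exact: vring_const.
- by apply: vringD => //; exact: vring_const.
- by left; exact: place_over_unique s2 PE Rx H.
- right; apply: place_over_unique ns2 QE Rx _.
  by rewrite scaleNr opprK.
Qed.

End Chart.
End Charts.

(** * Derivations of the function field *)

Section Derivations.
Variables (k : fieldType) (K : fieldAlgType k) (M : lmodType K).
Variable d : K -> M.
Hypothesis dP : is_derivation d.

Lemma derivation0 : d 0 = 0.
Proof. by have [_ _ /(_ 0)] := dP; rewrite scale0r. Qed.

Lemma derivation_horner_alg x q :
  d (horner_alg x q) = horner_alg x q^`() *: d x.
Proof.
have [dD dM dC] := dP; elim/poly_ind: q => [|q c IH].
  by rewrite deriv0 !rmorph0 scale0r derivation0.
rewrite derivD derivM derivX derivC mulr1 addr0 !rmorphD !rmorphM /=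
  horner_algX.
rewrite horner_algC dD dM dC IH addr0 scalerDl scalerA [X in _ = X]addrC.
by rewrite [in RHS]mulrC.
Qed.

Lemma Omega_lift_sum (s : seq (K * K)) :
  Omega_lift d (\sum_(p <- s) p.1 *: dK p.2) = \sum_(p <- s) p.1 *: d p.2.
Proof.
have L := Omega_lift_linear dP; elim: s => [|p s IH].
  by rewrite !big_nil; have := L (-1) 0 0; rewrite scaler0 addr0 scaleN1r addNr.
by rewrite !big_cons L IH Omega_lift_d.
Qed.

End Derivations.

Section RegularDerivation.
Variables (k : fieldType) (K : fieldAlgType k) (D : K -> K^o).
Hypothesis DP : is_derivation D.

Lemma regular_derivationD z w : D (z + w) = (D z + D w : K).
Proof. by have [dD _ _] := DP; exact: dD. Qed.

Lemma regular_derivationM z w : D (z * w) = (z * D w + w * D z : K).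
Proof. by have [_ dM _] := DP; exact: dM. Qed.

Lemma regular_derivation_horner_alg x q :
  D (horner_alg x q) = (horner_alg x q^`() * D x : K).
Proof. exact: derivation_horner_alg. Qed.

(** Contraction with a vector field that preserves the local ring sends [a d b] to [a (D b)]; this
    replaces the computation of orders of differentials. *)
Lemma stalkOmega_lift (P : place K) (w : Omega_k K) :
  (forall z, P z -> P (D z)) -> stalkOmega P w -> P (Omega_lift D w).
Proof.
move=> DS [s sP ->]; rewrite Omega_lift_sum //.
elim: s sP => [|p s IH] sP; first by rewrite big_nil; exact: vring0.
rewrite big_cons; apply: vringD; last first.
  by apply: IH => q qs; apply: sP; rewrite inE qs orbT.
have [|P1 P2] := sP p; first by rewrite inE eqxx.
by apply: (@vringM _ _ P p.1) => //; exact: DS.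
Qed.

End RegularDerivation.

(** * The vector field dual to [dx / y] on a plane model *)

Section ChartDerivations.
Variables (k : closedFieldType) (K : fieldAlgType k).
Variables (x y : K) (f : {poly k}).
Hypothesis C : chart x y f.
Hypothesis two0 : 2 != 0 :> k.
Let y2 := chart_eqn C.

Local Notation hx := (horner_alg x).
Local Notation aff := (affine x y).
Implicit Types (z w : K) (u v : {poly k} * {poly k}).

Lemma two_neq0 : 2 != 0 :> K.
Proof. by rewrite -scaler_nat scaler_eq0 negb_or two0 oner_eq0. Qed.

(** Since [2 y d y = d (f(x)) = 0] with [2 y] non-zero, [d] kills [y] as well, hence all fractions
    of affine functions. *)
Lemma derivation_eq0 (M : lmodType K) (d : K -> M) :
  is_derivation d -> d x = 0 -> forall z, d z = 0.
Proof.
move=> dP dx0 z; have [dD dM dC] := dP.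
have dh c : d (hx c) = 0 by rewrite derivation_horner_alg // dx0 scaler0.
have dy0 : d y = 0.
  have /eqP : (y + y) *: d y = 0 by rewrite scalerDl -dM -expr2 y2 dh.
  rewrite scaler_eq0 -mulr2n -mulr_natl mulf_eq0 (negPf two_neq0).
  by rewrite (negPf (chart_y_neq0 C)) => /eqP.
have [u [c [c0 zc]]] := chart_gen C z.
have /eqP : d (z * hx c) = 0.
  by rewrite zc /affine dD dM !dh dy0 !scaler0 !addr0.
by rewrite dM dh scaler0 add0r scaler_eq0 (hx_eq0 C) (negPf c0) => /eqP.
Qed.

(* The vector field [y d/dx], dual to the differential [dx / y], on affine
   functions; [2 y dy = f' dx] gives its value on [y]. *)
Definition aderiv u : {poly k} * {poly k} :=
  (u.2^`() * f + 2^-1 *: (u.2 * f^`()), u.1^`()).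

Lemma hx_half c : hx (2^-1 *: c) = hx c / 2.
Proof.
apply: (mulIf two_neq0); rewrite divfK ?two_neq0 //.
rewrite -(rmorph_nat (horner_alg x) 2) -rmorphM /= mulr_natr -scaler_nat.
by rewrite scalerA mulfV // scale1r.
Qed.

Lemma aff_aderiv u : aff (aderiv u) =
  hx u.1^`() * y + hx u.2^`() * y ^+ 2 + hx u.2 * hx f^`() / 2.
Proof. by rewrite y2 /affine /= rmorphD /= hx_half !rmorphM /=; ring. Qed.

Lemma aff_aderivM u v :
  aff (aderiv (amul f u v)) = aff u * aff (aderiv v) + aff v * aff (aderiv u).
Proof.
rewrite !aff_aderiv /amul /affine /= !(derivD, derivM).
rewrite !(rmorphD, rmorphM) /= -!y2.
by have two0K := two_neq0; field.
Qed.

Lemma aff_aderivD u v :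
  aff (aderiv (u + v)) = aff (aderiv u) + aff (aderiv v).
Proof. by rewrite !aff_aderiv /= !derivD !rmorphD /=; ring. Qed.

Lemma aff_aderivC c : aff (aderiv (c, 0)) = hx c^`() * y.
Proof. by rewrite aff_aderiv /= deriv0 rmorph0; ring. Qed.

(** The quotient rule for [z = u / c] prescribes [D z = (D u - z c' y) / c]. Applying the Leibniz
    rule to [u c1 = u1 c] shows independence of the fraction, and sums and products are checked over
    common denominators. *)
Lemma exists_chart_derivation :
  exists2 D : K -> K^o, is_derivation D & D x = y.
Proof.
have /choice[D DE] : forall z, exists w, forall u c, c != 0 ->
    z * hx c = aff u -> w * hx c = aff (aderiv u) - z * hx c^`() * y.
  move=> z; have [u [c [c0 zc]]] := chart_gen C z.
  have c0' : hx c != 0 by rewrite (hx_eq0 C).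
  exists ((aff (aderiv u) - z * hx c^`() * y) / hx c) => u1 c1 c10 zc1.
  have /(congr1 (fun u => aff (aderiv u))) :
      amul f u (c1, 0) = amul f u1 (c, 0).
    by apply: (affine_inj C); rewrite !(affineM C) !affineC -zc -zc1; ring.
  rewrite !aff_aderivM !aff_aderivC !affineC -zc -zc1 => E.
  apply: (mulIf c0'); rewrite mulrAC divfK //.
  apply/eqP; rewrite -subr_eq0; apply/eqP.
  by move/eqP: E; rewrite -subr_eq0 => /eqP <-; ring.
exists D; last first.
  have := DE x ('X, 0) 1; rewrite oner_eq0 affineC horner_algX rmorph1 mulr1.
  by rewrite aff_aderivC derivX derivC rmorph1 rmorph0 mulr0 mul0r subr0 mul1r
    mulr1; exact.
have DE' z u c : c != 0 -> z * hx c = aff u ->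
    aff (aderiv u) = D z * hx c + z * hx c^`() * y.
  by move=> c0 zc; rewrite (DE _ _ _ c0 zc) subrK.
split.
- move=> z w; have [u1 [c1 [c10 zc1]]] := chart_gen C z.
  have [u2 [c2 [c20 wc2]]] := chart_gen C w.
  have c0 : c1 * c2 != 0 by rewrite mulf_neq0.
  have c0' : hx (c1 * c2) != 0 by rewrite (hx_eq0 C).
  apply: (mulIf c0'); rewrite -[X in X * _ = _]/(D (z + w) : K).
  rewrite (DE _ (amul f u1 (c2, 0) + amul f u2 (c1, 0))) //; last first.
    by rewrite affineD !(affineM C) !affineC -zc1 -wc2 rmorphM /=; ring.
  rewrite aff_aderivD !aff_aderivM !aff_aderivC !affineC.
  rewrite (DE' _ _ _ c10 zc1) (DE' _ _ _ c20 wc2) -zc1 -wc2 derivM.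
  by rewrite -[X in _ = X * _]/(D z + D w : K) !(rmorphD, rmorphM) /=; ring.
- move=> z w; have [u1 [c1 [c10 zc1]]] := chart_gen C z.
  have [u2 [c2 [c20 wc2]]] := chart_gen C w.
  have c0 : c1 * c2 != 0 by rewrite mulf_neq0.
  have c0' : hx (c1 * c2) != 0 by rewrite (hx_eq0 C).
  apply: (mulIf c0'); rewrite -[X in X * _ = _]/(D (z * w) : K).
  rewrite (DE _ (amul f u1 u2)) //; last first.
    by rewrite !(affineM C) -zc1 -wc2 rmorphM /=; ring.
  rewrite aff_aderivM (DE' _ _ _ c10 zc1) (DE' _ _ _ c20 wc2) -zc1 -wc2 derivM.
  by rewrite -[X in _ = X * _]/(z * D w + w * D z : K) !(rmorphD, rmorphM) /=;
    ring.
- move=> c; have := DE c%:A (c%:P, 0) 1.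
  rewrite oner_eq0 affineC horner_algC aff_aderivC !derivC !rmorph0 rmorph1.
  by rewrite !mulr1 mulr0 !mul0r subr0; exact.
Qed.

Section Preserve.
Variable D : K -> K^o.
Hypotheses (DP : is_derivation D) (Dx : D x = y).

Lemma chart_derivation_affine u : D (aff u) = aff (aderiv u).
Proof.
have Dy : D y = (hx f^`() / 2 : K).
  have y0 := chart_y_neq0 C; have := regular_derivationM DP y y.
  rewrite -expr2 y2 (regular_derivation_horner_alg DP) Dx => E.
  apply: (mulIf y0); rewrite mulrAC E; by have two0K := two_neq0; field.
rewrite aff_aderiv /affine (regular_derivationD DP) (regular_derivationM DP).
rewrite !(regular_derivation_horner_alg DP) Dx Dy.
rewrite -[LHS]/(_ + _ : K); ring.
Qed.

(** By the quotient rule the denominator [v] only becomes [v^2], still non-zero at the point. *)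
Lemma at_point_derivation r s z : s ^+ 2 = f.[r] ->
  at_point x y r s z -> at_point x y r s (D z).
Proof.
move=> s2 [u [v [vr zE]]].
exists (amul f (aderiv u) v - amul f u (aderiv v)), (amul f v v).
rewrite avalM // mulf_neq0 //; split=> //.
have /(congr1 D) := zE; rewrite (regular_derivationM DP)
  !chart_derivation_affine => E.
have affB u1 u2 : aff (u1 - u2) = aff u1 - aff u2.
  by rewrite -{2}(subrK u2 u1) [in RHS]affineD addrK.
rewrite affB !(affineM C) -E -zE -[X in X * _ = _]/(D z : K); ring.
Qed.

(** The map [z |-> d z - (D z) dx / y] is a derivation that kills [x], hence zero: [dx / y] spans
    the differentials and [D] gives the coordinate. *)
Lemma Omega_lift_dual (w : Omega K) :
  w = (Omega_lift D w : K) *: (y^-1 *: dK x).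
Proof.
have y0 := chart_y_neq0 C; have [dD dM dC] := dK_derivation K.
have E z : dK z = (D z : K) *: (y^-1 *: dK x).
  pose d z : Omega K := dK z - (D z : K) *: (y^-1 *: dK x).
  apply/eqP; rewrite -subr_eq0; apply/eqP; apply: (@derivation_eq0 _ d).
    split=> [a b|a b|c]; rewrite /d.
    - by rewrite dD regular_derivationD // scalerDl opprD addrACA.
    - rewrite dM regular_derivationM // scalerDl !scalerBr !scalerA.
      by rewrite opprD addrACA.
    - by have [_ _ ->] := DP; rewrite dC scale0r subrr.
  by rewrite /d Dx scalerA mulfV // scale1r subrr.
have [s ->] := Omega_spanned w; rewrite Omega_lift_sum // scaler_suml.
by apply: eq_bigr => p _; rewrite {1}E scalerA.
Qed.

End Preserve.
End ChartDerivations.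

(** * Affine and infinite charts of a hyperelliptic curve *)

Section Polynomials.
Variable k : closedFieldType.
Implicit Types (q : {poly k}) (b r : k).

Lemma no_root_polyC q : (forall r, ~~ root q r) -> exists2 c, c != 0 & q = c%:P.
Proof.
move=> nr; have [|/closed_rootP[r]] := eqVneq (size q) 1;
  last by rewrite (negPf (nr r)).
by move/eqP/size_poly1P.
Qed.

Lemma size_XaddC_exp b n : size (('X + b%:P) ^+ n) = n.+1.
Proof. by rewrite -[b%:P]opprK -polyCN size_exp_XsubC. Qed.

Lemma coef_XaddC_expn b n : (('X + b%:P) ^+ n.+1)`_n = n.+1%:R * b.
Proof.
elim: n => [|n IH]; first by rewrite expr1 coefD coefX coefC add0r mul1r.
rewrite exprSr mulrDr coefD coefMX coefMC /= IH.
have /monicP : ('X + b%:P) ^+ n.+1 \is monic by rewrite monic_exp // monicXaddC.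
rewrite lead_coefE size_XaddC_exp /= => ->.
by rewrite -[n.+2]addn1 natrD mulrDl.
Qed.

(* The coefficient of degree [n - 1] of [q (X + b) - q], where [n] is the degree
   of [q], is [n * b * lead_coef q]. *)
Lemma translation_invariant_degree q b :
  b != 0 -> q \Po ('X + b%:P) = q -> (size q).-1%:R = 0 :> k.
Proof.
move=> b0 qb; case qn: (size q) => [|[|n]] //=.
have : (q \Po ('X + b%:P))`_n = q`_n by rewrite qb.
rewrite comp_polyE qn coef_sum 2!big_ord_recr /= big1 ?add0r => [|i _];
  last first.
  by rewrite coefZ [X in _ * X]nth_default ?mulr0 // size_XaddC_exp.
rewrite !coefZ coef_XaddC_expn.
have /monicP : ('X + b%:P) ^+ n \is monic by rewrite monic_exp // monicXaddC.
rewrite lead_coefE size_XaddC_exp /= => ->; rewrite mulr1 => /eqP.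
rewrite -subr_eq0 addrAC subrr add0r !mulf_eq0 (negPf b0) orbF => /orP[|/eqP//].
by move/eqP => qn0; have /eqP := qn0; rewrite -[n.+1]/(n.+2.-1) -qn
  lead_coef_eq0 -size_poly_eq0 qn.
Qed.

Lemma squarefree_smooth q : (forall r, ~~ (('X - r%:P) ^+ 2 %| q)) ->
  forall r, q.[r] != 0 \/ q^`().[r] != 0.
Proof.
move=> sq r; have [qr|] := eqVneq q.[r] 0; [right|by left].
have /root_factor[q1 qE] : root q r by apply/eqP.
rewrite qE derivM derivXsubC !hornerE subrr mulr0 add0r.
apply: contraNneq (sq r) => /eqP/root_factor[q2 q1E].
by rewrite qE q1E -mulrA -expr2 dvdp_mull.
Qed.

(** This is [X^n q(1/X)], with [q] regarded as of formal degree [n]. *)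
Definition rev_poly n q := \poly_(i < n.+1) q`_(n - i).

Lemma size_rev_poly n q : (size (rev_poly n q) <= n.+1)%N.
Proof. exact: size_poly. Qed.

Lemma size_rev_poly_eq n q : q.[0] != 0 -> size (rev_poly n q) = n.+1.
Proof. by rewrite horner_coef0 => q0; rewrite size_poly_eq //= subnn. Qed.

Lemma rev_poly0 n : rev_poly n 0 = 0.
Proof. by apply/polyP => i; rewrite coef_poly !coef0 if_same. Qed.

Lemma rev_polyK n q : (size q <= n.+1)%N -> rev_poly n (rev_poly n q) = q.
Proof.
move=> qn; apply/polyP => i; rewrite coef_poly; case: ltnP => ni; last first.
  by rewrite nth_default // (leq_trans qn).
by rewrite coef_poly ltnS leq_subr subKn.
Qed.

Lemma horner_alg_wide (A : semiAlgType k) (x : A) n q : (size q <= n)%N ->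
  horner_alg x q = \sum_(i < n) q`_i *: x ^+ i.
Proof.
move=> qn; have {1}-> : q = \sum_(i < n) q`_i *: 'X^i.
  rewrite -poly_def; apply/polyP => i; rewrite coef_poly.
  by case: ltnP => // ni; rewrite nth_default // (leq_trans qn).
rewrite rmorph_sum; apply: eq_bigr => i _.
by rewrite -mul_polyC rmorphM rmorphXn /= horner_algC horner_algX mulr_algl.
Qed.

Lemma horner_alg_rev (K : fieldAlgType k) (x : K) n q : x != 0 ->
  (size q <= n.+1)%N ->
  horner_alg x^-1 (rev_poly n q) = x^-1 ^+ n * horner_alg x q.
Proof.
move=> x0 qn; rewrite (horner_alg_wide _ (size_rev_poly n q)).
rewrite (horner_alg_wide _ qn) mulr_sumr (reindex_inj rev_ord_inj) /=.
apply: eq_bigr => i _; have iN : (i <= n)%N by rewrite -ltnS.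
rewrite subSS coef_poly ltnS leq_subr subKn // -scalerAr; congr (_ *: _).
have -> : x^-1 ^+ n = x^-1 ^+ (n - i) * x^-1 ^+ i by rewrite -exprD subnK.
by rewrite -mulrA -exprMn mulVf // expr1n mulr1.
Qed.

End Polynomials.

(** * The two charts of the hyperelliptic curve and the lifts of translations *)

Section Hyperelliptic.
Variables (k : closedFieldType) (K : fieldAlgType k) (x y : K).
Variables (f : {poly k}) (m : nat).
Hypothesis f_size : size f = m.*2.+2.
Implicit Types (z : K) (u v : {poly k} * {poly k}) (c q : {poly k}).

Local Notation hx := (horner_alg x).
Local Notation aff := (affine x y).

(** The degrees have different parity, as size [m.*2.+2] means degree [2m + 1]. *)
Lemma odd_degree_not_square c1 c2 q :
  size q = m.*2.+2 -> c2 != 0 -> c1 ^+ 2 <> c2 ^+ 2 * q.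
Proof.
move=> qm c20 E; have q0 : q != 0 by rewrite -size_poly_eq0 qm.
have c10 : c1 != 0.
  by rewrite -sqrf_eq0 E mulf_neq0 ?expf_neq0.
have /(congr1 (fun c : {poly k} => size c)) := E; rewrite !expr2.
rewrite !size_mul ?mulf_neq0 // qm.
move: c10 c20; rewrite -!size_poly_gt0.
by move: (size c1) (size c2) => n1 n2; clear; lia.
Qed.

Section AffineChart.
Hypothesis x_tr : transcendental x.
Hypothesis xy_gen : generated_by x y.
Hypothesis y2 : y ^+ 2 = hx f.

(** Freeness holds because [f], being of odd degree, is not a square in [k(x)]; denominators are
    made polynomials in [x] by multiplication with the conjugate. *)
Lemma affine_chart : chart x y f.
Proof.
have hx_inj : injective hx.
  by move=> q1 q2 q12; apply/eqP; rewrite -subr_eq0; apply/eqP/x_tr;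
    rewrite rmorphB /= q12 subrr.
have free u : aff u = 0 -> u = 0.
  case: u => u1 u2 /eqP; rewrite /affine /= addr_eq0 => /eqP E.
  have [u20|u20] := eqVneq u2 0.
    by move: E; rewrite u20 rmorph0 mul0r oppr0 => /x_tr ->.
  case: (odd_degree_not_square (q := f) (c1 := u1) (c2 := u2)) => //.
  by apply: hx_inj; rewrite [RHS]rmorphM !rmorphXn /= E -y2; ring.
split=> // z; have [u [v [v0 ->]]] := xy_gen z.
have aff2 (q : {poly {poly k}}) : exists u', horner2 x y q = aff u'.
  rewrite /horner2; elim/poly_ind: q => [|q c [u' E]].
    by exists (0, 0); rewrite /affine !rmorph0 horner0; ring.
  exists (u'.2 * f + c, u'.1); rewrite rmorphD rmorphM /= map_polyX map_polyC
    !hornerE.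
  by rewrite E /affine rmorphD rmorphM /= -y2; ring.
have [[u' uE] [v' vE]] := (aff2 u, aff2 v).
move: v0; rewrite uE vE => v0; pose vb := (v'.1, - v'.2).
have vbE : hx (v'.1 ^+ 2 - v'.2 ^+ 2 * f) = aff v' * aff vb.
  by rewrite /affine /vb !(rmorphB, rmorphM, rmorphXn, rmorphN) /= -y2; ring.
exists (amul f u' vb), (v'.1 ^+ 2 - v'.2 ^+ 2 * f); split.
  rewrite -(inj_eq hx_inj) vbE rmorph0 mulf_neq0 //.
  apply: contra_neqN v0 => /eqP/free[v1 /eqP]; rewrite oppr_eq0 => /eqP v2.
  by rewrite /affine v1 v2 !rmorph0; ring.
rewrite vbE mulrA divfK // /affine /amul /vb /=.
by rewrite !(rmorphD, rmorphM, rmorphN) /= -y2; ring.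
Qed.
End AffineChart.

Hypothesis C : chart x y f.
Let y2 := chart_eqn C.

Lemma chart_x_neq0 : x != 0.
Proof. by rewrite -(horner_algX x) (hx_eq0 C) polyX_eq0. Qed.
Local Notation x0 := chart_x_neq0.

Local Notation t := x^-1.
Definition y_inf : K := y * t ^+ m.+1.
(** The formal degree [2m + 2] exceeds the degree of [f] by one, so [f_inf] vanishes at 0: infinity
    is the branch point [(0, 0)] of the chart [w^2 = f_inf(t)]. *)
Definition f_inf : {poly k} := rev_poly m.*2.+2 f.
Local Notation w := y_inf.
Local Notation ht := (horner_alg t).

Lemma horner_alg_inv n q : (size q <= n.+1)%N ->
  ht q = t ^+ n * hx (rev_poly n q).
Proof.
by move=> qn; rewrite -{1}(rev_polyK qn) horner_alg_rev ?x0 // size_rev_poly.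
Qed.

Lemma tx_exp n : t ^+ n * x ^+ n = 1.
Proof. by rewrite -exprMn mulVf ?x0 // expr1n. Qed.

Lemma affine_inf u n : (size u.1 <= n.+1)%N -> (size u.2 <= n.+1)%N ->
  affine t w u * x ^+ (n + m.+1) =
  aff ('X^(m.+1) * rev_poly n u.1, rev_poly n u.2).
Proof.
move=> u1n u2n; rewrite /affine (horner_alg_inv u1n) (horner_alg_inv u2n) /=.
rewrite /y_inf rmorphM rmorphXn /= horner_algX exprD.
rewrite -[RHS]mul1r -[X in _ = X * _](tx_exp n).
rewrite [in RHS]mulrDr -[hx (rev_poly n u.2) * y]mul1r -[X in _ = _ + _ *
  (X * _)](tx_exp m.+1).
ring.
Qed.

Lemma chart_inf : chart t w f_inf.
Proof.
split.
- rewrite /f_inf horner_alg_rev ?x0 ?f_size // -y2 /y_inf exprMn -exprM mulrC.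
  by rewrite muln2 doubleS.
- move=> u u0; pose n := (size u.1 + size u.2)%N.
  have [n1 n2] : (size u.1 <= n.+1)%N /\ (size u.2 <= n.+1)%N by rewrite /n;
    lia.
  have := affine_inf n1 n2; rewrite u0 mul0r => /esym/(chart_free C)[/eqP].
  rewrite mulf_eq0 expf_eq0 polyX_eq0 andbF /= => /eqP r1 r2.
  rewrite [u]surjective_pairing -(rev_polyK n1) -(rev_polyK n2) r1 r2.
  by rewrite rev_poly0.
- move=> z; have [u [c [c0 zc]]] := chart_gen C z.
  pose n := (size u.1 + size u.2 + size c)%N.
  have [n1 n2 n3] : [/\ (size u.1 <= n.+1)%N,
    (size u.2 <= n.+1)%N & (size c <= n.+1)%N].
    by rewrite /n; split; lia.
  exists ('X^(m.+1) * rev_poly n u.1, rev_poly n u.2),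
    ('X^(m.+1) * rev_poly n c).
  split.
    rewrite mulf_neq0 ?expf_neq0 ?polyX_eq0 //.
    apply: contraNneq c0 => rc; rewrite -(rev_polyK n3) rc.
    by rewrite rev_poly0.
  rewrite /affine /= !rmorphM !rmorphXn /= horner_algX !horner_alg_rev ?x0 //.
  rewrite /y_inf; transitivity (t ^+ m.+1 * t ^+ n * (z * hx c)); first by ring.
  by rewrite zc /affine; ring.
Qed.

Lemma f_inf0 : f_inf.[0] = 0.
Proof. by rewrite horner_coef0 coef_poly /= subn0 nth_default // f_size. Qed.

Hypothesis two0 : 2 != 0 :> k.

(** The functions [x] and [y] have poles of order [2] and [2m + 1] at infinity, so no cancellation
    occurs between the two terms. The point is its own conjugate, so [at_point_conj] provides a
    denominator in [k[t]]; clearing powers of [t] reduces the claim to a comparison of degrees. *)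
Lemma pole_order_inf n u : at_point t w 0 0 (t ^+ n * aff u) ->
  (size u.1 <= n.+1)%N /\ (u.2 != 0 -> (size u.2 + m <= n)%N).
Proof.
move=> zP; have s0 : (0 : k) ^+ 2 = f_inf.[0] by rewrite f_inf0 expr0n.
have [|v [c [c0 E]]] := at_point_conj chart_inf two0 s0 zP.
  by rewrite oppr0.
pose N := (size v.1 + size v.2 + size c)%N.
have [n1 n2 n3] : [/\ (size v.1 <= N.+1)%N, (size v.2 <= N.+1)%N & (size c <=
  N.+1)%N].
  by rewrite /N; split; lia.
(* As [c] does not vanish at 0, its reversal has degree exactly [N], which makes the comparison
   sharp. *)
have rcN := size_rev_poly_eq N c0.
have rc0 : rev_poly N c != 0 by rewrite -size_poly_eq0 rcN.
have /(affine_inj C) : aff (u.1 * rev_poly N c * 'X^(m.+1),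
  u.2 * rev_poly N c * 'X^(m.+1)) =
    aff ('X^n * ('X^(m.+1) * rev_poly N v.1), 'X^n * rev_poly N v.2).
  transitivity (affine t w v * x ^+ (N + m.+1) * x ^+ n); last first.
    by rewrite (affine_inf n1 n2) /affine !(rmorphM, rmorphXn) /= horner_algX;
      ring.
  rewrite -E (horner_alg_inv n3) /affine !(rmorphM,
    rmorphXn) /= horner_algX exprD.
  rewrite -[LHS]mul1r -[X in X * _ = _](tx_exp n) -[LHS]mul1r -[X in X * _ =
    _](tx_exp N).
  ring.
have size_l q : q != 0 -> size (q * rev_poly N c * 'X^(m.+1)) = (size q + N +
  m.+1)%N.
  move=> q0; rewrite size_mulXn ?mulf_neq0 // size_mul // rcN.
  by move: (size q) => j; clear; lia.
have size_r j (q : {poly k}) : (size ('X^j * q)%R <= j + size q)%N.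
  by rewrite mulrC; have [->|q0] := eqVneq q 0;
    rewrite ?mul0r ?size_poly0 // size_mulXn.
move=> [E1 E2]; split.
  have [->|u10] := eqVneq u.1 0; first by rewrite size_poly0.
  have := size_l _ u10; rewrite E1.
  have := size_r n ('X^(m.+1) * rev_poly N v.1);
    have := size_r m.+1 (rev_poly N v.1).
  have := size_rev_poly N v.1; lia.
move=> u20; have := size_l _ u20; rewrite E2.
have := size_r n (rev_poly N v.2); have := size_rev_poly N v.2; lia.
Qed.

Hypothesis f_sqfree : forall r : k, ~~ (('X - r%:P) ^+ 2 %| f).

(** At a root [r] of a reduced denominator [c], regularity at both points above [r] gives another
    denominator [d] with [d(r)] non-zero; then [u d = v c] forces both coordinates of [u] to vanish
    at [r]. So [c] is constant. *)
Lemma regular_finite z :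
  (forall r s, s ^+ 2 = f.[r] -> at_point x y r s z) -> exists u, z = aff u.
Proof.
move=> zreg; have [u [c [c0 zc red]]] := reduced_rep C z.
have [|c1 c10 cE] := @no_root_polyC _ c; last first.
  exists (c1^-1 *: u.1, c1^-1 *: u.2); have c1A : c1%:A != 0 :> K.
    by rewrite scaler_eq0 negb_or c10 oner_eq0.
  apply: (mulIf c1A); rewrite -(horner_algC x) -cE zc /affine /= cE.
  have half q : hx q = hx (c1^-1 *: q) * hx c1%:P.
    by rewrite -rmorphM /= mulrC mul_polyC scalerA mulfV // scale1r.
  by rewrite (half u.1) (half u.2); ring.
move=> r; apply/negP => cr.
have [s s2] := sqrt_closed f.[r].
have ns2 : (- s) ^+ 2 = f.[r] by rewrite sqrrN.
have [v [d [dr zd]]] := at_point_conj C two0 s2 (zreg _ _ s2) (zreg _ _ ns2).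
have : amul f u (d, 0) = amul f v (c, 0).
  by apply: (affine_inj C); rewrite !(affineM C) !affineC -zc -zd; ring.
move=> E; case/negP: (red r cr); rewrite /root.
have := congr1 (fun p => p.1.[r]) E; have := congr1 (fun p => p.2.[r]) E.
rewrite /= !hornerE (eqP cr) => /eqP + /eqP.
by rewrite !(mulr0, mul0r, addr0, add0r, mulf_eq0, (negPf dr), orbF) => -> ->.
Qed.

Hypothesis f_monic : f \is monic.

(** The linear coefficient of [f_inf] is the leading coefficient of [f]. *)
Lemma f_inf_smooth : f_inf^`().[0] != 0.
Proof.
rewrite horner_coef0 coef_deriv coef_poly /= subSS subn0 mulr1n.
have /monicP := f_monic; rewrite lead_coefE f_size /= => ->; exact: oner_neq0.
Qed.

Lemma pullback_horner_alg (s : curve_aut K) b q : pullback s x = x + b%:A ->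
  pullback s (hx q) = hx (q \Po ('X + b%:P)).
Proof.
move=> sx; elim/poly_ind: q => [|q c IH]; first by rewrite comp_poly0 !rmorph0.
rewrite comp_polyD comp_polyM comp_polyX comp_polyC !(rmorphD, rmorphM) /= IH.
by rewrite horner_algX !horner_algC sx linearZ /= rmorph1.
Qed.

(** Write the image of [y] as [(u.1 + u.2 y) / c]; its square is [F(x)]. The coefficient of [y]
    gives [u.1 u.2 = 0], and [u.2 = 0] would make [F], of odd degree, a square. So
    [u.2^2 f = c^2 F], where squarefreeness makes [u.2] and [c] constant; comparing leading
    coefficients finishes. *)
Lemma pullback_y (s : curve_aut K) b : pullback s x = x + b%:A ->
  f \Po ('X + b%:P) = f /\ (pullback s y = y \/ pullback s y = - y).
Proof.
move=> sx; set F := f \Po _.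
have F_size : size F = m.*2.+2.
  by rewrite size_comp_poly2 ?size_XaddC.
have F_monic : F \is monic.
  rewrite monicE lead_coef_comp ?size_XaddC // lead_coefXaddC expr1n mulr1.
  by rewrite (eqP f_monic).
have F_sqfree r : ~~ (('X - r%:P) ^+ 2 %| F).
  apply: contra (f_sqfree (r + b)) => /dvdpP[q qE].
  have -> : f = F \Po ('X - b%:P).
    by rewrite /F -comp_polyA comp_polyD comp_polyX comp_polyC subrK
      comp_polyXr.
  rewrite qE comp_polyM rmorphXn /= rmorphB /= comp_polyX comp_polyC.
  by rewrite [(r + b)%:P]rmorphD /= opprD addrA addrAC dvdp_mull.
have [u [c [c0 zc red]]] := reduced_rep C (pullback s y).
have /(affine_inj C) [E1 E2] : aff (amul f u u) = aff (c ^+ 2 * F, 0).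
  rewrite (affineM C) affineC -zc rmorphM rmorphXn /= -(pullback_horner_alg _
    sx).
  by rewrite -y2 rmorphXn /=; ring.
have u1 : u.1 = 0.
  have /eqP : 2 * (u.1 * u.2) = 0 by rewrite -[RHS]E2; ring.
  rewrite !mulf_eq0 -polyC_natr polyC_eq0 (negPf two0) /= =>
    /orP[/eqP//|/eqP u2].
  case: (odd_degree_not_square (q := F) (c1 := u.1) (c2 := c)) => //.
  by rewrite -E1 u2; ring.
have {}E1 : u.2 ^+ 2 * f = c ^+ 2 * F by rewrite -E1 u1; ring.
(* A root of one square factor that is not a root of the other is a multiple root of the remaining
   factor. *)
have sq_root r q1 q2 q3 q4 : q1 ^+ 2 * q3 = q2 ^+ 2 * q4 ->
    root q2 r -> ~~ root q1 r ->
    ('X - r%:P) ^+ 2 %| q3.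
  move=> E /root_factor[q5 q2E] q1r.
  rewrite -(@Gauss_dvdpr _ _ (q1 ^+ 2)).
    by rewrite E q2E exprMn -mulrA dvdp_mull // dvdp_mulr.
  by rewrite coprimep_expl // coprimep_expr // coprimep_sym coprimep_XsubC.
have [r|c1 c10 cE] := @no_root_polyC _ c.
  apply/negP => cr; case/negP: (f_sqfree r); apply: sq_root E1 (cr) _.
  by have := red r cr; rewrite u1 root0.
have [r|b1 b10 bE] := @no_root_polyC _ u.2.
  apply/negP => ur; case/negP: (F_sqfree r); apply: sq_root (esym E1) (ur) _.
  by apply/negP => cr; have := red r cr; rewrite u1 root0 ur.
move: E1 zc; rewrite cE bE -!rmorphXn /= !mul_polyC => E1 zc.
have bc : b1 ^+ 2 = c1 ^+ 2.
  have /(congr1 lead_coef) := E1; rewrite !lead_coefZ (eqP f_monic) (eqP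
    F_monic).
  by rewrite !mulr1.
split.
  by apply: (scalerI (expf_neq0 2 c10)); rewrite -E1 bc.
have c1A : c1%:A != 0 :> K by rewrite scaler_eq0 negb_or c10 oner_eq0.
move: zc; rewrite /affine u1 bE rmorph0 add0r !horner_algC => zc.
have /eqP := bc; rewrite eqf_sqr => /orP[/eqP bcE|/eqP bcE]; [left|right];
  by apply: (mulIf c1A); rewrite zc bcE ?scaleNr mulrC // mulrN mulNr.
Qed.

End Hyperelliptic.

(** * Splittings and Cech cocycles *)

Section Cech.
Variables (k : fieldType) (K : fieldAlgType k).
Implicit Types (P Q R : place K).

Lemma zopen_finite (U V : set (place K)) :
  (forall R, ~ U R -> V R) -> finite_set V -> zopen U.
Proof. by move=> UV fV; right; apply: sub_finite_set fV. Qed.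

Lemma delta0_cocycle1 (V : lmodType k) (g : place K -> V) : cocycle1 (delta0 g).
Proof.
by move=> P Q R; rewrite /delta0 opprB [X in X + _]addrC !subrKA subrr.
Qed.

Lemma stalkOmega_dK P (z : K) : P z -> stalkOmega P (dK z).
Proof.
move=> Pz; exists [:: (1, z)]; last by rewrite big_seq1 scale1r.
by move=> p; rewrite inE => /eqP ->; split=> //; exact: vring1.
Qed.

Lemma pull_Z1dR (t : curve_aut K) (c : dRcochain K) :
  Z1dR K c -> Z1dR K (pull_dR t c).
Proof.
case=> [[U cU c1] c2 cd]; split; last 1 first.
- move=> P Q; have := cd (aut_place t P) (aut_place t Q).
  move=> /(congr1 (Omega_pull t)).
  by rewrite Omega_pull_d /delta0 Omega_pullB.
- exists (fun P => [set Q | U (aut_place t P) (aut_place t Q)]%classic).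
    exact: pull_cover.
  by move=> P Q UQ; apply: pull_stalkOmega; exact: c1.
- exact: pull_Z1.
Qed.

Lemma dKB (u v : K) : dK (u - v) = (dK u - dK v : Omega K).
Proof.
have [dD _ _] := dK_derivation K.
by rewrite -{2}(subrK v u) [in RHS]dD addrK.
Qed.

Lemma Omega_pullD (t : curve_aut K) (u v : Omega_k K) :
  Omega_pull t (u + v) = Omega_pull t u + Omega_pull t v.
Proof. by rewrite -{2}(addrK v u) Omega_pullB subrK. Qed.

(* If [(eta, delta0 gamma)] is a de Rham cocycle, then [eta P - d (gamma P)]
   does not depend on [P]; this is [w]. *)
Lemma invariant_lift (G : set (curve_aut K)) (t : curve_aut K)
    (gamma : place K -> K) (P0 : place K) : hodge_deRham_splits G -> G t ->
  Z1 (@stalkO _ K) (delta0 gamma) ->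
  cech0 (@stalkO _ K) (fun P => pullback t (gamma (aut_place t P)) - gamma P) ->
  exists (w : Omega_k K) (c : K), [/\
    forall P, stalkOmega P (w + dK (gamma P) : Omega_k K),
    forall P, P c & Omega_pull t w = w - dK c].
Proof.
move=> [s [sproj sG]] Gt Zgamma gamma_inv.
pose c0 := sqclass (Z1 (@stalkO _ K)) (B1 (@stalkO _ K)) (delta0 gamma).
have c0_inv : H1O_pull t c0 = c0.
  rewrite H1O_pullE //; apply/sqclass_eq => //; first exact: pull_Z1.
  exists (fun P => pullback t (gamma (aut_place t P)) - gamma P) => //.
  apply/funext => P; apply/funext => Q.
  rewrite -[LHS]/(pullback t (gamma _ - gamma _) - (gamma Q - gamma P)).
  by rewrite rmorphB /delta0; ring.
(* The cocycle [r] represents the image of the class under the splitting. Its function part is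
   [delta0 gamma] up to the boundary of a regular [g], and by equivariance its pull-back differs
   from it by the boundary of a regular [h]. *)
have [Zr rE] := sqreprP (s c0); set r := sqrepr (s c0) in Zr rE.
have Zr2 : Z1 (@stalkO _ K) r.2 by case: Zr.
have [g g0 gE] : B1 (@stalkO _ K) (r.2 - delta0 gamma).
  by apply/(sqclass_eq _ Zr2 Zgamma); rewrite -H1dR_projE // rE sproj.
have [h h0 [h1 h2]] : B1dR K (pull_dR t r - r).
  apply/(sqclass_eq _ (pull_Z1dR t Zr) Zr).
  by rewrite -H1dR_pullE // rE -sG // c0_inv.
pose gg P := gamma P + g P.
have r2E P Q : r.2 P Q = gg Q - gg P.
  have /(congr1 (fun F => F P Q)) := gE.
  rewrite -[LHS]/(r.2 P Q - (gamma Q - gamma P)) -[RHS]/(g Q - g P) => E.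
  by rewrite -[LHS](subrK (gamma Q - gamma P)) E /gg; ring.
have [[U cU r1U] _ rd] := Zr.
have [V cV gV] := g0; have [W cW hW] := h0.
have r1E P Q : r.1 Q - dK (gg Q) = r.1 P - dK (gg P) :> Omega K.
  have := rd P Q; rewrite r2E dKB -[delta0 _ _ _]/(r.1 Q - r.1 P) => E.
  have -> : r.1 Q = r.1 P + (dK (gg Q) - dK (gg P)) :> Omega K.
    by rewrite -E addrC subrK.
  by rewrite addrA addrAC addrK.
pose w : Omega K := r.1 P0 - dK (gg P0).
have wE P : r.1 P = w + dK (gg P) by rewrite /w (r1E P) subrK.
pose gt P := pullback t (gg (aut_place t P)).
have hE P Q : h Q - h P = (gt Q - gg Q) - (gt P - gg P).
  have /(congr1 (fun F => F P Q)) := h2.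
  rewrite -[RHS]/(h Q - h P) => <-.
  rewrite -[LHS]/(pullback t (r.2 _ _) - r.2 P Q) !r2E rmorphB /gt; ring.
(* By [hE] the difference [gt P - gg P - h P] is the same at all [P], so regularity of [c] can be
   checked at each [P] separately. *)
pose c := gt P0 - gg P0 - h P0.
have cE P : c = gt P - gg P - h P.
  by rewrite -[h P](subrK (h P0)) hE /c; ring.
exists w, c; split.
- move=> P; have -> : w + dK (gamma P) = (-1) *: (dK (g P) : Omega_k K) + r.1 P.
    have [dD _ _] := dK_derivation K.
    by rewrite scaleN1r wE /gg dD [RHS]addrC [w + (_ + _)]addrA addrK.
  apply: (sm_closed (stalkOmega P)).2; last by apply: r1U; case: (cU P).
  by apply: stalkOmega_dK; apply: gV; case: (cV P).
- move=> P; have [A cA eA] := gamma_inv; have gtV := pull_cech0 t g0.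
  have [A' cA' eA'] := gtV.
  have -> : c = (pullback t (gamma (aut_place t P)) - gamma P) +
      (pullback t (g (aut_place t P)) - g P - h P).
    by rewrite (cE P) /gt /gg rmorphD; ring.
  apply: vringD; first by apply: eA; case: (cA P).
  apply: vringB; last by apply: hW; case: (cW P).
  by apply: vringB; [apply: eA'; case: (cA' P)|apply: gV; case: (cV P)].
- have /(congr1 (fun F => F P0)) := h1.
  rewrite -[LHS]/(Omega_pull t (r.1 _) - r.1 P0) !wE Omega_pullD Omega_pull_d.
  have -> : h P0 = gt P0 - gg P0 - c by rewrite /c; ring.
  rewrite -/(gt P0); move: (c) => c1; rewrite !dKB opprD addrACA [LHS]addrC.
  by move=> /addrI E; rewrite -[LHS](subrK w) E addrC.
Qed.

End Cech.

(** * The class of [y / x ^ m] *)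

Section Splitting.
Variables (k : closedFieldType) (K : fieldAlgType k) (x y : K).
Variables (f : {poly k}) (m : nat).
Hypothesis two0 : 2 != 0 :> k.
Hypotheses (f_monic : f \is monic) (f_size : size f = m.*2.+2).
Hypothesis f_sqfree : forall r : k, ~~ (('X - r%:P) ^+ 2 %| f).
Hypothesis C : chart x y f.
Variables (s : curve_aut K) (b : k).
Hypotheses (sx : pullback s x = x + b%:A) (sy : pullback s y = y).
Implicit Types (P R : place K) (z : K) (q : {poly k}).

Let y2 := chart_eqn C.
Let x0 := chart_x_neq0 C.
Let Cinf := chart_inf f_size C.
Local Notation hx := (horner_alg x).
Local Notation aff := (affine x y).
Local Notation t := x^-1.
Local Notation w := (y_inf x y m).

Let z0 : K := y * t ^+ m.
(** A cochain of rational functions, [P x] singling out the finite places. It need not be regular,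
    but its boundary is a cocycle of regular functions, representing the class of [z0]. *)
Let gamma P : K := if `[< P x >] then 0 else z0.

Lemma finite_places_inf : finite_set [set R : place K | ~ R x]%classic.
Proof.
have := @finite_places_over _ _ _ _ _ Cinf two0 0.
by rewrite scale0r subr0 invrK; apply; right; exact: f_inf_smooth.
Qed.

Lemma finite_places_at r :
  finite_set [set R : place K | ~ R (x - r%:A)^-1]%classic.
Proof. exact: (finite_places_over C two0 (squarefree_smooth f_sqfree r)). Qed.

Lemma exists_place_inf : exists P : place K,
  ~ P x /\ forall z, P z <-> at_point t w 0 0 z.
Proof.
have s0 : (0 : k) ^+ 2 = (f_inf f m).[0] by rewrite f_inf0 // expr0n.
have [|P PE] := place_at Cinf two0 s0.
  by right; exact: f_inf_smooth.
exists P; split=> // /PE Px.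
have /(pole_order_inf f_size C two0)[/=] : at_point t w 0 0 (t ^+ 0 * aff ('X,
  0)).
  by rewrite expr0 mul1r affineC horner_algX.
by rewrite size_polyX.
Qed.

Lemma regular_y P : P x -> P y.
Proof.
by move=> Px; apply: vring_sqrt; rewrite y2; exact: vring_horner_alg.
Qed.

Lemma regular_y_inf P : ~ P x -> P t /\ P w.
Proof.
move=> Px; have Pt : P t by have [] := vring_val P x.
split=> //; apply: vring_sqrt; rewrite (chart_eqn Cinf);
  exact: vring_horner_alg.
Qed.

Lemma regular_shift P : P (x + b%:A) <-> P x.
Proof.
have Pb := vring_const P b; split=> [Pxb|Px]; last exact: vringD.
by rewrite -[x](addrK b%:A); exact: vringB.
Qed.

Lemma pullback_z0 : pullback s z0 = y * (x + b%:A)^-1 ^+ m.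
Proof. by rewrite /z0 rmorphM rmorphXn fmorphV /= sx sy. Qed.

(** With [e = x / (x + b)], which is regular at infinity, the difference is [z0 (e^m - 1)]. It is
    divisible by [e - 1 = - b t e], and [z0 t = w] is regular. *)
Lemma regular_inf_pullback_z0 P : ~ P x -> P (pullback s z0 - z0).
Proof.
move=> nPx; have [Pt Pw] := regular_y_inf nPx.
have Mt : pmax P t by right; rewrite invrK.
have Pb := vring_const P b.
pose e := (1 + b%:A * t)^-1.
have e_unit : ~ pmax P (1 + b%:A * t).
  move=> Me; apply: (@pmax_const _ _ P 1); first exact: oner_neq0.
  have -> : 1%:A = 1 + b%:A * t - b%:A * t by rewrite scale1r addrK.
  by apply: pmaxB => //; exact: pmaxM.
have Pe : P e by have [//|nPe] := EM (P e); case: e_unit; right.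
have e0 : 1 + b%:A * t != 0 by apply/eqP => e0; apply: e_unit; left.
have xb : (x + b%:A)^-1 = e * t.
  by rewrite /e -invfM mulrDl mul1r -mulrA mulVf // mulr1.
have -> : pullback s z0 - z0 = - (w * b%:A * e * \sum_(i < m) e ^+ (m.-1 - i) *
  1 ^+ i).
  rewrite pullback_z0 xb exprMn /z0.
  have E : e ^+ m - 1 = (e - 1) * \sum_(i < m) e ^+ (m.-1 - i) * 1 ^+ i.
    by case: (m) => [|n]; rewrite ?expr0 ?big_ord0 ?subrr ?mulr0 // -subrXX
      expr1n.
  have e1 : e - 1 = - (b%:A * t * e) by rewrite -{1}(mulVf e0) -/e; ring.
  transitivity (y * t ^+ m * (e ^+ m - 1)); first by ring.
  by rewrite E e1 /y_inf exprS; ring.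
apply: vringN; apply: vringM; first by do 2!apply: vringM => //.
elim/big_ind: _ => [|u v|i _]; [exact: vring0|exact: vringD|].
by rewrite expr1n mulr1; exact: vringX.
Qed.

Lemma finite_poles_pullback_z0 :
  finite_set [set R : place K | ~ R (pullback s z0 - z0)]%classic.
Proof.
apply: (@sub_finite_set _ _ ([set R : place K | ~ R (x - 0%:A)^-1] `|`
   [set R : place K | ~ R (x - (- b)%:A)^-1])%classic); last first.
  by rewrite finite_setU; split; exact: finite_places_at.
move=> R /= nR; apply: contrapT => /not_orP; rewrite !notK scale0r subr0.
rewrite scaleNr opprK => -[Rt Rbt]; apply: nR.
have [Rx|] := EM (R x); last exact: regular_inf_pullback_z0.
rewrite pullback_z0 /z0; have Ry := regular_y Rx.
by apply: vringB; apply: vringM => //; exact: vringX.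
Qed.

Lemma gamma_cocycle : Z1 (@stalkO _ K) (delta0 gamma).
Proof.
split; last exact: delta0_cocycle1.
(* Around a finite place all finite places are taken; around infinity the finite places where [z0]
   has a pole, all above [x = 0], are removed. *)
exists (fun P => [set R : place K | (P x -> R x) /\ (~ P x -> R x -> R
  z0)]%classic).
  move=> P; split=> //=.
  apply: (@zopen_finite _ _ _ ([set R : place K | ~ R x] `|`
    [set R : place K | ~ R (x - 0%:A)^-1])%classic); last first.
    by rewrite finite_setU; split; [exact: finite_places_inf|exact:
      finite_places_at].
  move=> R /= nU; apply: contrapT => /not_orP; rewrite !notK scale0r subr0.
  move=> [Rx Rt]; apply: nU; split=> // _ _.
  by apply: vringM; [exact: regular_y|exact: vringX].
move=> P Q R [[PR PR'] [QR QR']]; rewrite -[stalkO R _]/(R (gamma Q - gamma P)).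
rewrite /gamma; case: asboolP => Qx; case: asboolP => Px.
- by rewrite subr0; exact: vring0.
- by rewrite sub0r; apply/vringN/PR'; [|exact: QR].
- by rewrite subr0; apply: QR'; [|exact: PR].
- by rewrite subrr; exact: vring0.
Qed.

Lemma gamma_pullbackE P : pullback s (gamma (aut_place s P)) - gamma P =
  if `[< P x >] then 0 else pullback s z0 - z0.
Proof.
rewrite /gamma; have -> : `[< aut_place s P x >] = `[< P x >].
  by apply: asbool_equiv_eq; rewrite aut_placeE sx; exact: regular_shift.
by case: asboolP => _; rewrite ?rmorph0 ?subr0.
Qed.

Lemma gamma_invariant : cech0 (@stalkO _ K)
  (fun P => pullback s (gamma (aut_place s P)) - gamma P).
Proof.
exists (fun P => [set R : place K | R (pullback s (gamma (aut_place s P)) -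
  gamma P)]%classic).
  move=> P; split; last first.
    rewrite /= gamma_pullbackE; case: asboolP => [_|]; first exact: vring0.
    exact: regular_inf_pullback_z0.
  apply: zopen_finite finite_poles_pullback_z0 => R /=; rewrite gamma_pullbackE.
  by case: asboolP => // _ []; exact: vring0.
by move=> P R; exact.
Qed.

(** Global functions are constant: regularity at finite points gives an affine function, and the
    bound on its pole at infinity with [n = 0] leaves only constants. *)
Lemma regular_everywhere_dK z : (forall P, P z) -> dK z = 0.
Proof.
move=> zreg; have [|u zE] := regular_finite C two0 (z := z).
  move=> r s' s2; have [P PE] := place_at C two0 s2 (squarefree_smooth f_sqfree
    r).
  exact/PE.
have [P [_ PE]] := exists_place_inf.
have /PE : P z by [].
rewrite zE -[aff u]mul1r -(expr0 t) => /(pole_order_inf f_size C two0)[u1 u2].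
have {}u2 : u.2 = 0.
  have [//|u20] := eqVneq u.2 0; have := u2 u20.
  by rewrite leqn0 addn_eq0 size_poly_eq0 (negPf u20).
have [_ _ dC] := dK_derivation K.
by rewrite expr0 mul1r /affine u2 rmorph0 mul0r addr0 (size1_polyC u1)
  horner_algC dC.
Qed.

(** * Invariant differentials and their behaviour at infinity *)

Section Differential.
Variables (D : K -> K^o).
Hypotheses (DP : is_derivation D) (Dx : D x = y).

(** This is the Leibniz rule for [y = z0 x^m] with [D y = f' / 2]. The coefficient of degree
    [2m + 1] on the right is [(2m + 1) / 2 - m = 1 / 2]. *)
Lemma derivation_z0 :
  D z0 * x ^+ m.+1 = hx (2^-1 *: ('X * f^`()) - m%:R *: f) :> K.
Proof.
have z0x : z0 * x ^+ m = y by rewrite /z0 -mulrA (tx_exp C) mulr1.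
have Dy : D y = hx (2^-1 *: f^`()).
  have := chart_derivation_affine C two0 DP Dx (0, 1).
  rewrite /affine /aderiv /= rmorph0 rmorph1 mul1r add0r => ->.
  by rewrite derivC mul0r mul1r deriv0 rmorph0 mul0r add0r addr0.
have xm : x * hx ('X^m)^`() = m%:R * x ^+ m.
  rewrite derivXn rmorphMn rmorphXn /= horner_algX mulr_natl.
  by case: (m) => [|n]; rewrite ?mulr0n ?mulr0 // mulrnAr -exprS.
have Dxm : D (x ^+ m) = (hx ('X^m)^`() * y : K).
  by rewrite -Dx -regular_derivation_horner_alg // rmorphXn /= horner_algX.
have E := regular_derivationM DP z0 (x ^+ m); rewrite z0x Dxm in E.
have -> : D z0 * x ^+ m.+1 = x * D y - (x * hx ('X^m)^`()) * y * z0 :> K.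
  by rewrite E exprS; ring.
rewrite xm Dy rmorphB /= scaler_nat rmorphMn /= -y2 scalerAr rmorphM /=.
by rewrite horner_algX -mulr_natl expr2 -{3}z0x; ring.
Qed.


(* [t ^+ m * x] times the vector field [y d/dx] is minus the vector field
   [w d/dt] of the chart at infinity. *)
Lemma regular_at_infinity (P : place K) (v : Omega_k K) :
  (forall z, P z <-> at_point t w 0 0 z) -> stalkOmega P v ->
  P (t ^+ m * x * (Omega_lift D v : K)).
Proof.
move=> PE Pv; pose Dinf : K -> K^o := fun z => - (t ^+ m * x) * (D z : K).
have DinfP : is_derivation Dinf.
  split=> [z1 z2|z1 z2|c]; rewrite /Dinf.
  - by rewrite regular_derivationD // mulrDr.
  - rewrite regular_derivationM // -[RHS]/(z1 * _ + z2 * _ : K); ring.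
  - by have [_ _ ->] := DP; rewrite mulr0.
have Dinft : Dinf t = w.
  have := regular_derivationM DP x t; rewrite mulfV // Dx => E.
  have D1 : D 1 = 0.
    by have [_ _ /(_ 1)] := DP; rewrite scale1r.
  have {}E : D t = - (t ^+ 2 * y) :> K.
    apply: (mulfI x0); apply: (addIr (t * y));
      rewrite -E D1 mulrN mulrA expr2 mulrA.
    by rewrite mulfV // mul1r addNr.
  rewrite /Dinf E /y_inf [t ^+ m.+1]exprS.
  transitivity (x * t * (t * t ^+ m * y)); first by ring.
  by rewrite mulfV // mul1r mulrC.
have s0 : (0 : k) ^+ 2 = (f_inf f m).[0] by rewrite f_inf0 // expr0n.
have Dinf_reg z : P z -> P (Dinf z).
  move=> /PE Pz; apply/PE; exact: (at_point_derivation Cinf two0 DinfP Dinft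
    s0).
set H : K := Omega_lift D v.
have vE : v = \sum_(p <- [:: (H * y^-1, x)]) p.1 *: dK p.2 :> Omega K.
  by rewrite big_seq1 /= -scalerA; exact: (Omega_lift_dual C two0 DP Dx v).
have := stalkOmega_lift DinfP Dinf_reg Pv; rewrite {1}vE Omega_lift_sum //.
rewrite big_seq1 -[_ *: _]/(H * y^-1 * (- (t ^+ m * x) * (D x : K))) Dx.
rewrite -[t ^+ m * x * H]mulr1 -(mulVf (chart_y_neq0 C)) => /vringN.
by congr (P _); ring.
Qed.

(** The differential [dx / y] is itself invariant, since [dx] is unchanged by a translation and [y]
    is fixed. *)
Lemma pullback_invariant_differential (v : Omega_k K) :
  Omega_pull s v = v -> pullback s (Omega_lift D v) = Omega_lift D v.
Proof.
set H : K := Omega_lift D v; have y0 := chart_y_neq0 C.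
have vE : v = \sum_(p <- [:: (H * y^-1, x)]) p.1 *: dK p.2 :> Omega K.
  by rewrite big_seq1 /= -scalerA; exact: (Omega_lift_dual C two0 DP Dx v).
rewrite {1}vE Omega_pullE big_seq1 /= sx => /(congr1 (Omega_lift D)).
have [dD _ dC] := dK_derivation K.
rewrite dD dC addr0 rmorphM fmorphV /= sy.
have := Omega_lift_sum DP [:: (pullback s H * y^-1, x)].
rewrite !big_seq1 /= => -> E; transitivity (pullback s H * y^-1 * D x : K).
  by rewrite Dx divfK.
exact: E.
Qed.

End Differential.

Lemma translation_not_splits (G : set (curve_aut K)) : b != 0 -> G s ->
  f \Po ('X + b%:P) = f -> ~ hodge_deRham_splits G.
Proof.
move=> b0 Gs fb splits.
have [P [Px PE]] := exists_place_inf.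
have [v [c [v_reg c_reg v_inv]]] :=
  invariant_lift P splits Gs gamma_cocycle gamma_invariant.
have {c c_reg} v_inv : Omega_pull s v = v.
  by rewrite v_inv regular_everywhere_dK // subr0.
have [D DP Dx] := exists_chart_derivation C two0.
have h_inv := pullback_invariant_differential DP Dx v_inv.
have [|[h0 h1] hE] := regular_finite C two0 (z := Omega_lift D v).
  move=> r s' s2; have [R RE] := place_at C two0 s2 (squarefree_smooth f_sqfree
    r).
  apply/RE/(stalkOmega_lift DP).
    by move=> z /RE Rz; apply/RE; exact: (at_point_derivation C two0 DP Dx s2).
  have := v_reg R; rewrite /gamma asboolT ?(derivation0 (dK_derivation K))
    ?addr0 //.
  apply/RE; exists ('X, 0), (1, 0).
  by rewrite /aval /= !hornerE oner_eq0 !affineC rmorph1 mulr1 horner_algX.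
have h0_inv : h0 \Po ('X + b%:P) = h0.
  move: h_inv; rewrite hE /affine /= rmorphD rmorphM /= sy.
  rewrite !(pullback_horner_alg _ sx).
  by move=> /(@affine_inj _ _ _ _ _ C (_, _) (h0, h1))[].
have := regular_at_infinity DP Dx PE (v_reg P).
rewrite /gamma asboolF // => /PE.
have L := Omega_lift_linear DP.
(* The part without [y] of [t^m x (h + D z0)], multiplied by [x^(2m)]. Regularity at infinity bounds
   its degree by [2m]. *)
pose q := 'X^(m.+1) * h0 + (2^-1 *: ('X * f^`()) - m%:R *: f).
rewrite (_ : _ * _ = t ^+ m.*2 * aff (q, 'X^(m.+1) * h1)); last first.
  have -> : Omega_lift D (v + dK z0 : Omega K) = (aff (h0, h1) + D z0 : K).
    have := Omega_lift_linear DP 1 v (dK z0);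
      rewrite !scale1r Omega_lift_d // => ->.
    by rewrite hE.
  rewrite /affine /q /= rmorphD /= -(derivation_z0 DP Dx) !rmorphM !rmorphXn /=
    horner_algX.
  rewrite -addnn exprD exprS -[LHS]mul1r -(tx_exp C m); ring.
move=> /(pole_order_inf f_size C two0)[/= /leq_sizeP q_size _].
have fm : f`_(m.*2.+1) = 1.
  by have /monicP := f_monic; rewrite lead_coefE f_size.
have qE i : q`_(m.+1 + i) = h0`_i + (2^-1 * (f`_(m.+1 + i) *+ (m.+1 + i)) -
  m%:R * f`_(m.+1 + i)).
  rewrite /q coefD coefXnM ltnNge leq_addr addKn /= coefB !coefZ coefXM
    coef_deriv.
  by rewrite addSn.
(* The vanishing coefficient of degree [2m + 1] of [q] determines this one; the higher coefficients
   of [q] involve [h0] only, so [h0] has degree exactly [m]. *)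
have h0m : h0`_m = - 2^-1.
  have := qE m; rewrite q_size addSn addnn // fm mulr1.
  have -> : 2^-1 * m.*2.+1%:R - m%:R = 2^-1 :> k.
    have -> : m.*2.+1%:R = 2 * m%:R + 1 :> k by rewrite -natrM natr1 mul2n.
    by field.
  by move=> /eqP; rewrite eq_sym addr_eq0 => /eqP.
have h0_size : size h0 = m.+1.
  apply/eqP; rewrite eqn_leq; apply/andP; split.
    apply/leq_sizeP => i mi; have := qE i.
    have fi : f`_(m.+1 + i) = 0 by rewrite nth_default // f_size; lia.
    by rewrite fi mul0rn !mulr0 subr0 addr0 q_size //; lia.
  by rewrite ltnNge; apply/negP => /leq_sizeP/(_ m (leqnn m))/eqP;
    rewrite h0m oppr_eq0 invr_eq0 (negPf two0).
have := translation_invariant_degree b0 h0_inv;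
  have := translation_invariant_degree b0 fb.
(* Invariance of [h0] gives [m = 0] in [k], that of [f] gives [2m + 1 = 0]; together they yield
   [1 = 0]. *)
rewrite h0_size f_size /= -addnn -addnS natrD => + m0;
  rewrite -addn1 natrD m0 !add0r.
by move/eqP; rewrite oner_eq0.
Qed.

End Splitting.

Theorem theorem3p3 (k : closedFieldType) (p : nat) (K : fieldAlgType k)
    (x y : K) (f : {poly k}) (g : nat) (tau : curve_aut K) (a : k) :
  p \in [pchar k] -> (3 <= p)%N ->
  transcendental x -> generated_by x y ->
  y ^+ 2 = horner_alg x f ->
  f \is monic -> (forall r : k, ~~ (('X - r%:P) ^+ 2 %| f)) ->
  genus K g -> (2 <= g)%N ->
  odd (size f).-1 ->
  a != 0 -> induces_translation tau x a ->
  ~ hodge_deRham_splits (generated [set tau]%classic).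
Proof.
move=> pk p3 x_tr xy_gen y2 f_monic f_sqfree _ _ f_odd a0 tau_x.
have two0 : 2 != 0 :> k.
  by rewrite -(dvdn_pcharf pk) gtnNdvd.
have f_size : size f = ((size f).-1)./2.*2.+2.
  by move: f_odd; case: (size f) => //= n; rewrite -{2}(odd_double_half n) =>
    ->.
have C := affine_chart f_size x_tr xy_gen y2.
have [_ tau_y] := pullback_y f_size C two0 f_sqfree f_monic tau_x.
(* Squaring removes the sign in the action on [y], and the translation by [2a] is still non-trivial
   as [2] is invertible. *)
have tau2_x : pullback (tau * tau)%g x = x + (a *+ 2)%:A.
  rewrite -[LHS]/(pullback tau (pullback tau x)) tau_x rmorphD /= linearZ /=.
  by rewrite rmorph1 tau_x -addrA -scalerDl.
have tau2_y : pullback (tau * tau)%g y = y.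
  rewrite -[LHS]/(pullback tau (pullback tau y)).
  by case: tau_y => E; rewrite !E ?rmorphN /= ?E ?opprK.
have [f_inv _] := pullback_y f_size C two0 f_sqfree f_monic tau2_x.
apply: (translation_not_splits two0 f_monic f_size f_sqfree C tau2_x tau2_y)
  f_inv.
  by rewrite -mulr_natr mulf_neq0.
by move=> H HG Htau; apply: (group_closedM HG); exact: Htau.
Qed.
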